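(* Let $N\ge2$ and let $X=\coprod_{2\ge v_1\ge\dots\ge v_{N-1}\ge0}T^*F(v_1,\dots,v_{N-1})$, where $F(v_1,\dots,v_{N-1})$ is the variety of flags $\mathbb C^2\supset V_1\supset\dots\supset V_{N-1}$ with $\dim V_k=v_k$. Let $A=(\mathbb C^* )^2$ act on $X$ via its standard action on $\mathbb C^2$, with characters $u_1,u_2$, and let $T=A\times\mathbb C^*$, where the extra factor scales the cotangent fibres with character $\hbar$. Identify $H_T^\bullet(X^A)$ with $\mathbb C^N\otimes\mathbb C^N\otimes\mathbb C[u_1,u_2,\hbar]$ via the basis of fixed points. Then, with $u=u_1-u_2$, $\mathfrak C_1=\{u>0\}$ and $\mathfrak C_2=\{u<0\}$, the $R$-matrix $R=\mathrm{Stab}_{\mathfrak C_2}^{-1}\circ\mathrm{Stab}_{\mathfrak C_1}$ equals $$R=\frac{u}{u+\hbar}\,\mathrm{Id}+\frac{\hbar}{u+\hbar}\,\mathrm P ,$$ where $\mathrm P(x\otimes y)=y\otimes x$ is the permutation operator on $\mathbb C^N\otimes\mathbb C^N$.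
   Context: **Fixed points.** Let $f_1,f_2$ be the coordinate basis of $\mathbb C^2$, of $A$-characters $u_1,u_2$. The fixed point labelled $e_{i_1}\otimes e_{i_2}$ ($1\le i_1,i_2\le N$, $e_i$ the standard basis of $\mathbb C^N$) is the flag (on the zero section) with $V_k=\mathrm{span}\{f_s: i_s>k\}$, $k=1,\dots,N-1$. The isolated fixed point is identified with the class $1$ on it. **Stable map.** $X$ is symplectic, $A$ preserves the symplectic form and $T$ scales it. For a chamber $\mathfrak C$ and a component $Z\subset X^A$, $\mathrm{Leaf}_{\mathfrak C}(Z)=\{x:\lim_{z\to0}\sigma(z)x\in Z\}$ for any cocharacter $\sigma\in\mathfrak C$. The partial order on components is generated by: $Z_1\succeq Z_2$ if $\overline{\mathrm{Leaf}_{\mathfrak C}(Z_1)}\cap Z_2\ne\emptyset$. Put $\mathrm{Slope}_{\mathfrak C}(Z)=\coprod_{Z'\preceq Z}\mathrm{Leaf}_{\mathfrak C}(Z')$. The normal bundle splits as $N_Z=N_+\oplus N_-$ according to whether $A$-weights are positive or negative on $\mathfrak C$. A polarization is a choice, for each $Z$, of a square root $\varepsilon$ of $(-1)^{\mathrm{codim}(Z)/2}e_A(N_Z)$. $\mathrm{Stab}_{\mathfrak C}:H_T^\bullet(X^A)\to H_T^\bullet(X)$ is the unique $H_T^\bullet(\mathrm{pt})$-linear map such that for every component $Z$ and $\gamma\in H_T^\bullet(Z)$ the class $\Gamma=\mathrm{Stab}_{\mathfrak C}(\gamma)$ satisfies: (i) $\Gamma$ is supported on $\mathrm{Slope}_{\mathfrak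 C}(Z)$; (ii) $\Gamma|_Z=\pm e(N_-)\cup\gamma$, where the sign is such that $\pm e(N_-)$ restricts to $\varepsilon$ in $A$-equivariant cohomology of a point; (iii) $\deg_A\Gamma|_{Z'}<\mathrm{codim}(Z')/2$ for every $Z'\prec Z$, where $\deg_A$ is the degree in $u_1,u_2$. It is an isomorphism after localization (tensoring with the fraction field of $H_T^\bullet(\mathrm{pt})$). **Polarization used** (for both chambers): $\varepsilon$ at a fixed point is the product of the $A$-weights of the tangent space of the flag variety (zero section) at that point.
   Formalization: In the definition of the stable map, the degree condition (iii) is required only for classes γ of degree 0 in u_1,u_2 (then extended linearly); demanded for every γ in H_T(Z), as written, it contradicts H_T(pt)-linearity and no such map exists. *)

(* Defs.v *)
(* MathComp-Analysis. *)
From HB Require Import structures.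
From mathcomp Require Import all_boot all_order all_algebra.
From mathcomp Require Import all_classical reals topology normedtype.
From mathcomp Require Import complex.
From mathcomp Require Import -(notations) mpoly.
From mathcomp Require Import zify ring.
Set Implicit Arguments.
Unset Strict Implicit.
Unset Printing Implicit Defensive.
Import Order.TTheory GRing.Theory Num.Theory.
Import numFieldTopology.Exports numFieldNormedType.Exports.
Local Open Scope classical_set_scope.
Local Open Scope ring_scope.

(* R[i] seen as a numClosedFieldType, so that it inherits the norm topology. *)
Definition cplx (R : realType) : numClosedFieldType := R[i].

Section Continuity.
Lemma ptws_continuous (I : Type) (T : topologicalType) (K : I -> topologicalType)
    (f : T -> prod_topology K) :
  (forall i, continuous (fun x => f x i)) -> continuous f.
Proof.
move=> cf x; apply/cvg_sup => i U [_ [[V oV <-] /= Vfx /filterS]]; apply.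
by apply: (cf i x); apply: open_nbhs_nbhs.
Qed.

Lemma ptws_proj_continuous (I : eqType) (K : I -> topologicalType) (i : I) :
  continuous (fun f : prod_topology K => f i).
Proof. exact: proj_continuous. Qed.
End Continuity.

Section Simplices.
Variable R : realType.

Definition stdsimplex (n : nat) : set {ptws 'I_n.+1 -> R} :=
  [set x | (forall i, 0 <= x i) /\ \sum_i x i = 1].

(* The affine map of standard simplices given by h on vertices. *)
Definition push (p n : nat) (h : 'I_p.+1 -> 'I_n.+1) (x : {ptws 'I_p.+1 -> R}) :
  {ptws 'I_n.+1 -> R} := fun j => \sum_(i | h i == j) x i.

Lemma push_subproof p n h (x : set_type (@stdsimplex p)) :
  @push p n h (set_val x) \in @stdsimplex n.
Proof.
have [x0 x1] := set_valP x; rewrite inE; split => [i|]; first by apply: sumr_ge0 => k _; exact: x0.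
by rewrite -x1 [RHS](partition_big h xpredT).
Qed.

Definition spush p n h (x : set_type (@stdsimplex p)) : set_type (@stdsimplex n) :=
  exist _ (push h (set_val x)) (push_subproof h x).

Lemma push_continuous p n h : continuous (@push p n h).
Proof.
apply: (@ptws_continuous _ _ (fun=> R : topologicalType)) => j.
apply: (@continuous_big R _ +%R 0 (fun i => h i == j) (@add_continuous R)
  {ptws 'I_p.+1 -> R} _ (fun i x => x i)) => i _.
exact: (@ptws_proj_continuous _ (fun=> R : topologicalType)).
Qed.

Lemma spush_continuous p n h : continuous (@spush p n h).
Proof.
apply: continuous_comp_initial => x.
apply: (@continuous_comp _ _ _ set_val (@push p n h)); last exact: push_continuous.
exact: initial_continuous.
Qed.

End Simplices.

Section Cochains.
Variables (R : realType) (Z : topologicalType) (A : set Z).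
Local Notation C := (cplx R).
Local Notation Delta n := (set_type (@stdsimplex R n)).

(* Singular simplices of the subspace A of Z. *)
Definition simplex (n : nat) : Type :=
  {s : Delta n -> Z | continuous s /\ forall x, A (s x)}.

Definition anysimplex : Type := {n & simplex n}.

Lemma face_subproof n p (h : nat -> nat) (s : simplex n) :
  let h' := fun i : 'I_p.+1 => inord (h i) : 'I_n.+1 in
  continuous (sval s \o spush h') /\ forall x, A ((sval s \o spush h') x).
Proof.
case: s => s [cs sA] /=; split => [x|x]; last exact: sA.
by apply: continuous_comp; [exact: spush_continuous|exact: cs].
Qed.

(* The singular p-simplex obtained by restricting s along h : [0, p] -> [0, n];
   the i-th face is face s n (bump i). *)
Definition face (s : anysimplex) (p : nat) (h : nat -> nat) : anysimplex :=
  existT simplex p (exist _ _ (face_subproof p h (tagged s))).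

Lemma simplexP n (s t : simplex n) : sval s =1 sval t -> s = t.
Proof. by move=> /funext st; apply: eq_sig_hprop => // f; exact: Prop_irrelevance. Qed.

Lemma eq_face s p q h k : p = q ->
  (forall i, (i <= p)%N -> h i = k i) -> face s p h = face s q k.
Proof.
move=> <- hk; rewrite /face; congr existT; apply: simplexP => x /=.
congr (sval _ _); apply/val_inj => /=; apply/funext => j.
by rewrite /push; apply: eq_bigl => i; rewrite hk // -ltnS.
Qed.

Lemma face_face s p q h k : (forall i, (i <= q)%N -> (k i <= p)%N) ->
  face (face s p h) q k = face s q (h \o k).
Proof.
move=> kp; rewrite /face /=; congr existT; apply: simplexP => x /=.
congr (sval _ _); apply/val_inj => /=; apply/funext => j.
have kK (i : 'I_q.+1) : (inord (k i) : 'I_p.+1) = k i :> nat.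
  by rewrite inordK // ltnS kp // -ltnS.
rewrite /push [RHS](partition_big (fun i : 'I_q.+1 => inord (k i) : 'I_p.+1)
   (fun i => inord (h i) == j)) /=; last by move=> i; rewrite kK.
apply: eq_bigr => i /eqP hij; apply: eq_bigl => l.
by case: eqP => [li|]; rewrite ?andbF // -kK li hij eqxx.
Qed.

(* A cochain has components in all degrees; those of bounded degree form the
   direct sum of the cochain groups. *)
Definition cochain := anysimplex -> C.

Definition coboundary (f : cochain) : cochain := fun s =>
  if tag s is n.+1 then \sum_(i < n.+2) (-1) ^+ i * f (face s n (bump i)) else 0.

(* Front face times back face, summed over all splittings of the degree. *)
Definition cup (f g : cochain) : cochain := fun s =>
  \sum_(p < (tag s).+1) f (face s p id) * g (face s (tag s - p) (addn p)).

Definition cochain1 : cochain := fun s => (tag s == 0)%:R.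


Lemma cochainP (f g : cochain) : (forall s, f s = g s) -> f = g.
Proof. exact: funext. Qed.

Lemma cochainDE (f g : cochain) s : (f + g) s = f s + g s.
Proof. by []. Qed.

Lemma cochainZE a (f : cochain) s : (a *: f) s = a * f s.
Proof. by []. Qed.

Lemma sum_coboundary_coboundary (n : nat) (s : anysimplex) (f : cochain) :
  \sum_(i < n.+3) \sum_(j < n.+2)
     (-1) ^+ (i + j) * f (face s n (bump i \o bump j)) = 0.
Proof.
pose F (i j : nat) := (-1) ^+ (i + j) * f (face s n (bump i \o bump j)).
rewrite (eq_bigr (fun i : 'I_n.+3 => \sum_(j < n.+2 | (j < i)%N) F i j +
   \sum_(j < n.+2 | (i <= j)%N) F i j)); last first.
  move=> i _; rewrite (bigID (fun j : 'I_n.+2 => (j < i)%N)) /=.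
  by congr +%R; apply: eq_bigl => j; rewrite -leqNgt.
rewrite big_split /=.
rewrite [X in X + _](exchange_big_dep xpredT) //= -[X in X + _]opprK.
apply/eqP; rewrite addrC subr_eq0; apply/eqP.
rewrite big_ord_recr /= [X in _ + X]big1 ?addr0; last first.
  by move=> j /leq_trans-/(_ _ (leq_ord j)); rewrite ltnn.
rewrite -sumrN; apply: eq_bigr => i _ /=.
have -> : \sum_(k < n.+3 | (i < k)%N) F k i =
    \sum_(j < n.+2 | (i <= j)%N) F j.+1 i.
  rewrite big_mkcond big_ord_recl /= add0r [RHS]big_mkcond /=.
  by apply: eq_bigr => j _; rewrite /bump /= add1n ltnS.
rewrite -sumrN; apply: eq_bigr => j ij.
rewrite /F addSn exprS mulN1r mulNr opprK addnC.
congr (_ * f _); apply: eq_face => // k _ /=; rewrite /bump; lia.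
Qed.

Lemma coboundaryK f : coboundary (coboundary f) = (fun=> 0).
Proof.
apply: cochainP => -[[|[|n]] s] //=.
  by rewrite /coboundary /= big1 // => i _; rewrite mulr0.
rewrite -(sum_coboundary_coboundary n (existT _ n.+2 s) f).
apply: eq_bigr => i _; rewrite /coboundary /= mulr_sumr; apply: eq_bigr => j _.
rewrite mulrA -exprD face_face // => k kn; rewrite /bump; lia.
Qed.

Definition grading_sign (f : cochain) : cochain := fun s => (-1) ^+ tag s * f s.

Lemma coboundary_cup f g : coboundary (cup f g) =
  cup (coboundary f) g \+ cup (grading_sign f) (coboundary g).
Proof.
apply: cochainP => -[[|n] s] /=.
  rewrite /cup /= !big_ord1 /coboundary /= mul0r mulr0 addr0 //.
set t := existT _ _ s.
rewrite /coboundary /= /cup /=.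
pose G i p := (-1) ^+ i * (f (face t p (bump i)) *
  g (face t (n - p) (bump i \o addn p))).
transitivity (\sum_(p < n.+1) \sum_(i < n.+2) G i p).
  rewrite exchange_big /=; apply: eq_bigr => i _; rewrite mulr_sumr.
  apply: eq_bigr => p _; rewrite /G !face_face //= => k; have := ltn_ord p; lia.
rewrite [X in _ = X + _]big_ord_recl [X in _ = _ + X]big_ord_recr /=.
rewrite subnn /= mul0r mulr0 add0r addr0 -big_split /=; apply: eq_bigr => p _.
rewrite /bump /= add1n subSS (subSn (leq_ord p)) /grading_sign /=.
rewrite mulr_suml -(big_mkord xpredT (fun i => G i p)).
rewrite (big_cat_nat (n := p.+1)) //=; last by have := ltn_ord p; lia.
rewrite big_mkord [X in _ = X + _]big_ord_recr /= -!addrA; congr +%R.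
  apply: eq_bigr => i _; rewrite /G -mulrA face_face; last first.
    by move=> k kp; rewrite /bump; lia.
  congr (_ * (f _ * g _)); apply: eq_face => // k _ /=.
  rewrite /bump; have := ltn_ord i; lia.
rewrite mulr_sumr big_ord_recl /= addrA.
rewrite [X in _ = X + _](_ : _ = 0) ?add0r; last first.
  rewrite !face_face; [|by move=> *; rewrite /bump; have := ltn_ord p; lia..].
  rewrite expr0 mul1r exprS mulN1r !mulNr -mulrA.
  rewrite (@eq_face t p p (id \o bump p.+1) id) //; last first.
    by move=> k kp /=; rewrite /bump; lia.
  rewrite (@eq_face t (n - p) (n - p) (addn p \o bump 0) (addn p.+1)) ?add0n;
    [by ring|by []|by move=> k _ /=; rewrite /bump; lia].
rewrite -[X in \sum_(X <= _ < _) _]add0n big_addn (_ : (n.+2 - p.+1)%N = (n - p).+1); last first.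
  by have := ltn_ord p; lia.
rewrite big_mkord; apply: eq_bigr => i _; rewrite /G face_face; last first.
  by move=> k kp; rewrite /bump; lia.
rewrite (_ : (i + p.+1)%N = p + i.+1)%N; last by lia.
rewrite exprD -!mulrA; congr (_ * _); rewrite [RHS]mulrCA.
congr (_ * (f _ * g _)); apply: eq_face => // k kp /=; rewrite /bump; lia.
Qed.

Lemma cupA : associative cup.
Proof.
move=> f g h; apply: cochainP => s; rewrite /cup /=; set n := tag s.
pose F p q := f (face s q id) * g (face s (p - q) (addn q)) *
  h (face s (n - p) (addn p)).
transitivity (\sum_(0 <= q < n.+1) \sum_(q <= p < n.+1) F p q).
  rewrite big_mkord; apply: eq_bigr => q _.
  rewrite mulr_sumr -[X in \sum_(X <= _ < _) _]add0n big_addn subSn ?leq_ord //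
    big_mkord.
  apply: eq_bigr => p _; rewrite /F mulrA !face_face; [|move=> k; have := ltn_ord p; lia..].
  rewrite addnK; congr (_ * _ * _); congr (_ _); apply: eq_face; rewrite ?addn0 //=; try lia.
transitivity (\sum_(0 <= p < n.+1) \sum_(0 <= q < p.+1) F p q); last first.
  rewrite big_mkord; apply: eq_bigr => p _; rewrite mulr_suml big_mkord.
  apply: eq_bigr => q _; rewrite /F !face_face //= => k; have := ltn_ord q; lia.
rewrite (eq_big_nat _ _ (F2 := fun q => \sum_(0 <= p < n.+1 | (q <= p)%N) F p q));
  last by move=> q _; rewrite (big_nat_widenl _ 0).
rewrite (exchange_big_dep_nat xpredT) //=; apply: eq_big_nat => p /andP[_ pn].
by rewrite [RHS](big_nat_widen _ _ n.+1).
Qed.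

Lemma face_id s h : (forall i, h i = i) -> face s (tag s) h = s.
Proof.
case: s => n s hid; rewrite /face /=; congr existT; apply: simplexP => x /=.
congr (sval _ _); apply/val_inj => /=; apply/funext => j; rewrite /push.
by rewrite (big_pred1 j) // => i; rewrite hid inord_val.
Qed.

Lemma cup1f : left_id cochain1 cup.
Proof.
move=> f; apply: cochainP => s; rewrite /cup big_ord_recl big1 => [|i _].
  by rewrite addr0 /cochain1 /= mul1r subn0 face_id.
by rewrite /cochain1 /= mul0r.
Qed.

Lemma cupf1 : right_id cochain1 cup.
Proof.
move=> f; apply: cochainP => s; rewrite /cup big_ord_recr big1 => [|i _].
  by rewrite /= add0r /cochain1 /= subnn mulr1 face_id.
by rewrite /cochain1 /= subn_eq0 leqNgt ltn_ord mulr0.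
Qed.

Lemma cupDl : left_distributive cup +%R.
Proof.
move=> f g h; apply: cochainP => s.
by rewrite [RHS]cochainDE /cup -big_split; apply: eq_bigr => p _; exact: mulrDl.
Qed.

Lemma cupDr : right_distributive cup +%R.
Proof.
move=> f g h; apply: cochainP => s.
by rewrite [RHS]cochainDE /cup -big_split; apply: eq_bigr => p _; exact: mulrDr.
Qed.

Definition bounded_deg (f : cochain) : Prop :=
  exists N, forall s, (N <= tag s)%N -> f s = 0.

Definition is_cocycle : {pred cochain} :=
  fun f => `[< bounded_deg f /\ coboundary f = 0 >].

Lemma coboundaryD f g : coboundary (f + g) = coboundary f + coboundary g.
Proof.
apply: cochainP => -[[|n] s]; rewrite [RHS]cochainDE /coboundary /= ?addr0 //.
by rewrite -big_split; apply: eq_bigr => p _; exact: mulrDr.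
Qed.

Lemma coboundaryZ a f : coboundary (a *: f) = a *: coboundary f.
Proof.
apply: cochainP => -[[|n] s]; rewrite [RHS]cochainZE /coboundary /= ?mulr0 //.
by rewrite mulr_sumr; apply: eq_bigr => p _; rewrite mulrCA.
Qed.

Lemma bounded_degD f g : bounded_deg f -> bounded_deg g -> bounded_deg (f + g).
Proof.
move=> [M fM] [N gN]; exists (maxn M N) => s; rewrite geq_max => /andP[Ms Ns].
by rewrite cochainDE fM ?gN ?addr0.
Qed.

Lemma bounded_degZ a f : bounded_deg f -> bounded_deg (a *: f).
Proof. by move=> [M fM]; exists M => s Ms; rewrite fctE fM ?scaler0. Qed.

Lemma bounded_cup f g : bounded_deg f -> bounded_deg g -> bounded_deg (cup f g).
Proof.
move=> [M fM] [N gN]; exists (M + N)%N => s MNs; rewrite /cup big1 // => p _.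
have [Mp|pM] := leqP M p; first by rewrite fM ?mul0r.
by rewrite [g _]gN ?mulr0 //=; lia.
Qed.

Lemma cocycle_submod : subsemimod_closed is_cocycle.
Proof.
split; [split|].
- apply/asboolP; split; first by exists 0.
  by have := coboundaryZ 0 0; rewrite !scale0r.
- move=> f g /asboolP[bf df] /asboolP[bg dg]; apply/asboolP.
  by split; [exact: bounded_degD|rewrite coboundaryD df dg addr0].
- move=> a f /asboolP[bf df]; apply/asboolP.
  by split; [exact: bounded_degZ|rewrite coboundaryZ df scaler0].
Qed.

HB.instance Definition _ := GRing.isSubmodClosed.Build C cochain is_cocycle
  cocycle_submod.

Record cocycle := Cocycle { cocycle_val :> cochain; _ : cocycle_val \in is_cocycle }.

HB.instance Definition _ := [isSub for cocycle_val].
HB.instance Definition _ := [Choice of cocycle by <:].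
HB.instance Definition _ := [SubChoice_isSubLmodule of cocycle by <:].

Lemma cocycleP (f : cocycle) : bounded_deg f /\ coboundary f = 0.
Proof. by case: f => f /= /asboolP. Qed.

Lemma cup_subproof (f g : cocycle) : cup f g \in is_cocycle.
Proof.
have [[bf df] [bg dg]] := (cocycleP f, cocycleP g).
apply/asboolP; split; first exact: bounded_cup.
rewrite coboundary_cup df dg; apply: cochainP => s /=.
by rewrite /cup !big1 ?addr0 // => p _; rewrite ?mul0r ?mulr0.
Qed.

Lemma cochain1_subproof : cochain1 \in is_cocycle.
Proof.
apply/asboolP; split; first by exists 1%N => -[[|n] s].
apply: cochainP => -[[|n] s] //=; rewrite /coboundary /cochain1 /=.
case: n s => [|n] s; last by rewrite big1 // => i _; rewrite mulr0.
by rewrite !big_ord_recl big_ord0 expr0 expr1 !mulr1 addr0 subrr.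
Qed.

Definition cocycle_mul (f g : cocycle) := Cocycle (cup_subproof f g).

Definition cocycle1 := Cocycle cochain1_subproof.

Lemma cocycle_mulA : associative cocycle_mul.
Proof. by move=> f g h; apply/val_inj; exact: cupA. Qed.
Lemma cocycle_mul1f : left_id cocycle1 cocycle_mul.
Proof. by move=> f; apply/val_inj; exact: cup1f. Qed.
Lemma cocycle_mulf1 : right_id cocycle1 cocycle_mul.
Proof. by move=> f; apply/val_inj; exact: cupf1. Qed.
Lemma cocycle_mulDl : left_distributive cocycle_mul +%R.
Proof. by move=> f g h; apply/val_inj; exact: cupDl. Qed.
Lemma cocycle_mulDr : right_distributive cocycle_mul +%R.
Proof. by move=> f g h; apply/val_inj; exact: cupDr. Qed.

HB.instance Definition _ := GRing.Zmodule_isPzRing.Build cocycle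
  cocycle_mulA cocycle_mul1f cocycle_mulf1 cocycle_mulDl cocycle_mulDr.

Definition is_coboundary : {pred cocycle} :=
  fun f => `[< exists2 g, bounded_deg g & f = coboundary g :> cochain >].

Lemma coboundary_zmod : zmod_closed is_coboundary.
Proof.
split.
  apply/asboolP; exists 0; first by exists 0.
  by have := coboundaryZ 0 0; rewrite !scale0r => ->.
move=> f g /asboolP[h bh fE] /asboolP[k bk gE]; apply/asboolP.
exists (h + (-1) *: k); first by apply: bounded_degD => //; exact: bounded_degZ.
by rewrite coboundaryD coboundaryZ -fE -gE scaleN1r.
Qed.

HB.instance Definition _ := GRing.isZmodClosed.Build cocycle is_coboundary
  coboundary_zmod.

Lemma coboundaryMl (f g : cocycle) : g \in is_coboundary -> f * g \in is_coboundary.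
Proof.
move=> /asboolP[h bh gE]; have [bf df] := cocycleP f; apply/asboolP.
exists (cup (grading_sign f) h).
  apply: bounded_cup => //; case: bf => N fN; exists N => s Ns.
  by rewrite /grading_sign fN ?mulr0.
rewrite coboundary_cup (_ : coboundary (grading_sign f) = 0); last first.
  apply: cochainP => -[[|n] s] //=; rewrite /coboundary /=.
  have := congr1 (fun k : cochain => k (existT _ n.+1 s)) df.
  rewrite /coboundary /= => dfs; transitivity ((-1) ^+ n * 0 : C); last exact: mulr0.
  rewrite -[X in _ = _ * X]dfs mulr_sumr.
  by apply: eq_bigr => i _; rewrite /grading_sign /= mulrCA.
apply: cochainP => s /=; rewrite /cup [X in _ = X + _]big1 ?add0r => [|p _]; last exact: mul0r.
apply: eq_bigr => p _; rewrite /grading_sign /= mulrA -exprD gE.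
by rewrite -signr_odd oddD addbb mul1r.
Qed.

Lemma coboundaryMr (f g : cocycle) : f \in is_coboundary -> f * g \in is_coboundary.
Proof.
move=> /asboolP[h bh fE]; have [bg dg] := cocycleP g; apply/asboolP.
exists (cup h g); first exact: bounded_cup.
rewrite coboundary_cup -fE dg; apply: cochainP => s /=.
by rewrite /cup [X in _ = _ + X]big1 ?addr0 // => p _; exact: mulr0.
Qed.

(* Singular cohomology of A with complex coefficients, the direct sum of all
   degrees, as a ring under the cup product. *)
Definition cohomology := Quotient.quot is_coboundary.

HB.instance Definition _ := EqQuotient.on cohomology.
HB.instance Definition _ := GRing.Zmodule.on cohomology.

Definition cohom_class (f : cocycle) : cohomology := \pi_cohomology%qT f.

Lemma cohom_classP f g : cohom_class f = cohom_class g <-> f - g \in is_coboundary.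
Proof.
by rewrite (Quotient.idealrBE is_coboundary); split => [/eqP|/eqP].
Qed.

Lemma cohom_classK x : cohom_class (repr x) = x.
Proof. exact: reprK. Qed.

Lemma cohom_classD f g : cohom_class (f + g) = cohom_class f + cohom_class g.
Proof. exact: (@Quotient.pi_add _ is_coboundary). Qed.

Definition cohom_mul (x y : cohomology) := cohom_class (repr x * repr y).
Definition cohom_scale (a : C) (x : cohomology) := cohom_class (a *: repr x).

Lemma cohom_mulE f g :
  cohom_mul (cohom_class f) (cohom_class g) = cohom_class (f * g).
Proof.
have repr_class h : repr (cohom_class h) - h \in is_coboundary.
  by apply/cohom_classP; rewrite cohom_classK.
apply/cohom_classP; set f' := repr _; set g' := repr _.
rewrite (_ : f' * g' - f * g = (f' - f) * g' + f * (g' - g)); last first.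
  by rewrite mulrBl mulrBr addrA subrK.
by apply: rpredD; [apply: coboundaryMr|apply: coboundaryMl]; exact: repr_class.
Qed.

Lemma cohom_scaleE a f : cohom_scale a (cohom_class f) = cohom_class (a *: f).
Proof.
apply/cohom_classP; rewrite -scalerBr.
have /asboolP[g bg gE] : repr (cohom_class f) - f \in is_coboundary.
  by apply/cohom_classP; rewrite cohom_classK.
apply/asboolP; exists (a *: g); first exact: bounded_degZ.
by rewrite coboundaryZ -gE.
Qed.

Lemma cohom_mulA : associative cohom_mul.
Proof.
move=> x y z; rewrite -[x]cohom_classK -[y]cohom_classK -[z]cohom_classK.
by rewrite !cohom_mulE mulrA.
Qed.
Lemma cohom_mul1x : left_id (cohom_class 1) cohom_mul.
Proof. by move=> x; rewrite -[x]cohom_classK cohom_mulE mul1r. Qed.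
Lemma cohom_mulx1 : right_id (cohom_class 1) cohom_mul.
Proof. by move=> x; rewrite -[x]cohom_classK cohom_mulE mulr1. Qed.
Lemma cohom_mulDl : left_distributive cohom_mul +%R.
Proof.
move=> x y z; rewrite -[x]cohom_classK -[y]cohom_classK -[z]cohom_classK.
by rewrite -cohom_classD !cohom_mulE mulrDl cohom_classD.
Qed.
Lemma cohom_mulDr : right_distributive cohom_mul +%R.
Proof.
move=> x y z; rewrite -[x]cohom_classK -[y]cohom_classK -[z]cohom_classK.
by rewrite -cohom_classD !cohom_mulE mulrDr cohom_classD.
Qed.

HB.instance Definition _ := GRing.Zmodule_isPzRing.Build cohomology
  cohom_mulA cohom_mul1x cohom_mulx1 cohom_mulDl cohom_mulDr.

Lemma cohom_scaleA a b x :
  cohom_scale a (cohom_scale b x) = cohom_scale (a * b) x.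
Proof. by rewrite -[x]cohom_classK !cohom_scaleE scalerA. Qed.
Lemma cohom_scale1 : left_id 1 cohom_scale.
Proof. by move=> x; rewrite -[x]cohom_classK cohom_scaleE scale1r. Qed.
Lemma cohom_scaleDr : right_distributive cohom_scale +%R.
Proof.
move=> a x y; rewrite -[x]cohom_classK -[y]cohom_classK.
by rewrite -cohom_classD !cohom_scaleE scalerDr cohom_classD.
Qed.
Lemma cohom_scaleDl x : {morph cohom_scale^~ x : a b / a + b}.
Proof.
move=> a b; rewrite -[x]cohom_classK.
by rewrite !cohom_scaleE scalerDl cohom_classD.
Qed.

HB.instance Definition _ := GRing.Zmodule_isLmodule.Build C cohomology
  cohom_scaleA cohom_scale1 cohom_scaleDr cohom_scaleDl.

Definition homogeneous (n : nat) (x : cohomology) : Prop :=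
  exists2 f : cocycle, cohom_class f = x & forall s, tag s <> n -> cocycle_val f s = 0.

End Cochains.

Section Pullback.
Variables (R : realType) (Z W : topologicalType) (A : set Z) (B : set W).
Variables (f : Z -> W) (cf : continuous f) (fAB : forall z, A z -> B (f z)).

Lemma push_simplex_subproof n (s : simplex R A n) :
  continuous (f \o sval s) /\ forall x, B ((f \o sval s) x).
Proof.
case: s => s [cs sA] /=; split => [x|x]; last exact: fAB.
by apply: continuous_comp; [exact: cs|exact: cf].
Qed.

Definition push_simplex (s : anysimplex R A) : anysimplex R B :=
  existT _ (tag s) (exist _ _ (push_simplex_subproof (tagged s))).

Definition pull_cochain (c : cochain R B) : cochain R A := c \o push_simplex.

Lemma pull_coboundary c :
  coboundary (pull_cochain c) = pull_cochain (coboundary c).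
Proof.
apply: cochainP => -[[|n] s] //=; rewrite /coboundary /=.
apply: eq_bigr => i _; congr (_ * c _); rewrite /push_simplex /face /=.
by congr existT; apply: simplexP.
Qed.

Lemma pull_cocycle_subproof (c : cocycle R B) :
  pull_cochain c \in @is_cocycle R Z A.
Proof.
have [[N cN] dc] := cocycleP c; apply/asboolP; split.
  by exists N => s Ns; apply: cN.
by rewrite pull_coboundary dc.
Qed.

Definition pull_cocycle (c : cocycle R B) : cocycle R A :=
  Cocycle (pull_cocycle_subproof c).

Definition pullback (x : cohomology R B) : cohomology R A :=
  cohom_class (pull_cocycle (repr x)).

Lemma pullbackE c : pullback (cohom_class c) = cohom_class (pull_cocycle c).
Proof.
apply/cohom_classP; have /asboolP[g [N gN] gE] :
    repr (cohom_class c) - c \in @is_coboundary R W B.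
  by apply/cohom_classP; rewrite cohom_classK.
apply/asboolP; exists (pull_cochain g); last by rewrite pull_coboundary -gE.
by exists N => s Ns; apply: gN.
Qed.

End Pullback.


Section Borel.
Variable R : realType.
Local Notation C := (cplx R).

Definition torus (r : nat) : set ('I_r -> C) := [set t | forall i, t i != 0].

(* Spaces with an action of the torus (C^* )^r; the action is only constrained
   on tuples of nonzero scalars. *)
Structure tspace (r : nat) := TSpace {
  tcarrier :> topologicalType;
  tact : ('I_r -> C) -> tcarrier -> tcarrier;
  tact1 : forall y, tact 1 y = y;
  tactM : forall s t y, torus s -> torus t -> tact (s * t) y = tact s (tact t y)
}.

(* ET is (C^N \ 0)^r, in the product topology: it is contractible, and the
   torus acts on it freely with local sections. *)
Definition universal (r : nat) : topologicalType := {ptws 'I_r -> {ptws nat -> C}}.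

Definition universal_free (r : nat) : set (universal r) :=
  [set e | forall i, exists n, e i n != 0].

Definition universal_act r (t : 'I_r -> C) (e : universal r) : universal r :=
  fun i n => t i * e i n.

Section Orbits.
Variables (r : nat) (Y : tspace r).

Definition diag_act (t : 'I_r -> C) (p : Y * universal r) : Y * universal r :=
  (tact t p.1, universal_act t p.2).

Definition orbit_rel : rel (Y * universal r) :=
  fun p q => `[< exists2 t, torus t & q = diag_act t p >].

Lemma diag_act1 p : diag_act 1 p = p.
Proof.
case: p => y e; rewrite /diag_act tact1; congr pair.
by apply/funext => i; apply/funext => n; rewrite /universal_act mul1r.
Qed.

Lemma diag_actM s t p : torus s -> torus t ->
  diag_act (s * t) p = diag_act s (diag_act t p).
Proof.
move=> Ts Tt; rewrite /diag_act tactM //; congr pair.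
by apply/funext => i; apply/funext => n; rewrite /universal_act /= mulrA.
Qed.

Lemma torus1 : torus (1 : 'I_r -> C).
Proof. by move=> i; exact: oner_neq0. Qed.

Lemma torusM (s t : 'I_r -> C) : torus s -> torus t -> torus (s * t).
Proof. by move=> Ts Tt i; apply: mulf_neq0. Qed.

Lemma orbit_equiv : equiv_class_of orbit_rel.
Proof.
split.
- by move=> p; apply/asboolP; exists 1; [exact: torus1|rewrite diag_act1].
- suff H p q : orbit_rel p q -> orbit_rel q p by move=> p q; apply/idP/idP; exact: H.
  move=> /asboolP[t Tt ->]; apply/asboolP.
  pose u : 'I_r -> C := fun i => (t i)^-1.
  have Tu : torus u by move=> i; rewrite invr_eq0.
  exists u => //; rewrite -diag_actM // (_ : u * t = 1) ?diag_act1 //.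
  by apply/funext => i; exact: mulVf.
- move=> q p s /asboolP[t Tt ->] /asboolP[u Tu ->]; apply/asboolP.
  by exists (u * t); [exact: torusM|rewrite diag_actM].
Qed.

Canonical orbit_equiv_rel := EquivRelPack orbit_equiv.

Definition homotopy_quotient :=
  quotient_topology {eq_quot orbit_rel}%qT.

HB.instance Definition _ := Topological.on homotopy_quotient.
HB.instance Definition _ := Quotient.on homotopy_quotient.

Definition orbit_class (p : Y * universal r) : homotopy_quotient :=
  \pi_homotopy_quotient%qT p.

Lemma orbit_classP p q : orbit_class p = orbit_class q <->
  exists2 t, torus t & q = diag_act t p.
Proof.
have e := @eqquotP _ orbit_equiv_rel {eq_quot orbit_equiv_rel}%qT p q.
by split => [/e/asboolP|pq] //; apply/e/asboolP.
Qed.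

Lemma orbit_class_continuous : continuous orbit_class.
Proof. exact: pi_continuous. Qed.

(* A x_T ET, for A stable under T. *)
Definition borel (A : set Y) : set homotopy_quotient :=
  orbit_class @` (A `*` @universal_free r).

End Orbits.

Section EquivariantMap.
Variables (r s : nat) (Y : tspace r) (W : tspace s).
Variable g : Y * universal r -> W * universal s.
Hypothesis cg : continuous g.
Hypothesis gE : forall p t, torus t -> orbit_class (g (diag_act t p)) = orbit_class (g p).

Definition quotient_map (x : homotopy_quotient Y) : homotopy_quotient W :=
  orbit_class (g (repr x)).

Lemma quotient_mapE p : quotient_map (orbit_class p) = orbit_class (g p).
Proof.
have : orbit_class p = orbit_class (repr (orbit_class p)) by rewrite {2}/orbit_class reprK.
by move=> /orbit_classP[t Tt e]; rewrite /quotient_map e gE.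
Qed.

Lemma quotient_map_continuous : continuous quotient_map.
Proof.
apply/quotient_continuous.
rewrite (_ : _ \o _ = @orbit_class _ W \o g); last first.
  by apply/funext => p; exact: quotient_mapE.
move=> x; apply: continuous_comp; first exact: cg.
exact: orbit_class_continuous.
Qed.

End EquivariantMap.
End Borel.


HB.instance Definition _ := hasNbhs.Build unit principal_filter.
HB.instance Definition _ := Discrete_ofNbhs.Build unit erefl.

Lemma pair_continuous (T U V : topologicalType) (f : T -> U) (g : T -> V) :
  continuous f -> continuous g -> continuous (fun x => (f x, g x)).
Proof. by move=> cf cg x; exact: (cvg_pair (cf x) (cg x)). Qed.

Lemma snd_continuous (U V : topologicalType) : continuous (@snd U V).
Proof. by move=> p; exact: (@cvg_snd _ _ (nbhs p.1) (nbhs p.2)). Qed.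

Section EquivariantCohomology.
Variable R : realType.
Local Notation C := (cplx R).

Definition point_tspace (r : nat) : tspace R r :=
  @TSpace R r unit (fun _ y => y) (fun=> erefl) (fun _ _ _ _ _ => erefl).

(* Borel equivariant cohomology H_T(A). *)
Definition eqcohom r (Y : tspace R r) (A : set Y) : Type :=
  cohomology R (borel A).

HB.instance Definition _ r (Y : tspace R r) (A : set Y) :=
  GRing.PzRing.on (eqcohom A).
HB.instance Definition _ r (Y : tspace R r) (A : set Y) :=
  GRing.Lmodule.on (eqcohom A).

Definition eqcohom_pt r : Type := eqcohom [set: point_tspace r].
HB.instance Definition _ r := GRing.PzRing.on (eqcohom_pt r).
HB.instance Definition _ r := GRing.Lmodule.on (eqcohom_pt r).

Lemma borelS r (Y : tspace R r) (A B : set Y) :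
  A `<=` B -> forall x, borel A x -> borel B x.
Proof. by move=> AB x [p [Ap fp] <-]; exists p => //; split => //; exact: AB. Qed.

Lemma id_continuous (T : topologicalType) : continuous (@id T).
Proof. by move=> x; exact: cvg_id. Qed.

Definition restrict r (Y : tspace R r) (A B : set Y) (AB : A `<=` B) :
  eqcohom B -> eqcohom A :=
  pullback (@id_continuous (homotopy_quotient Y)) (borelS AB).

Section ToPoint.
Variables (r : nat) (Y : tspace R r).

Definition to_point (p : Y * universal R r) : point_tspace r * universal R r :=
  (tt, p.2).

Lemma to_point_continuous : continuous to_point.
Proof. by apply: pair_continuous; [exact: cst_continuous|exact: snd_continuous]. Qed.

Lemma to_point_equivariant p t : torus t ->
  orbit_class (to_point (diag_act t p)) = orbit_class (to_point p).
Proof. by move=> Tt; apply/esym/orbit_classP; exists t. Qed.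

Lemma to_point_borel (A : set Y) x : borel A x ->
  borel [set: point_tspace r] (quotient_map to_point x).
Proof.
move=> [p [_ fp] <-]; rewrite quotient_mapE; last exact: to_point_equivariant.
by exists (to_point p).
Qed.

(* The pullback H_T(pt) -> H_T(A). *)
Definition structure_map (A : set Y) : eqcohom_pt r -> eqcohom A :=
  pullback (quotient_map_continuous to_point_continuous to_point_equivariant)
    (@to_point_borel A).
End ToPoint.

Section Characters.
Variables (r : nat) (i : 'I_r).

Definition coordinate (p : point_tspace r * universal R r) :
  point_tspace 1 * universal R 1 := (tt, fun=> p.2 i).

Lemma coordinate_continuous : continuous coordinate.
Proof.
apply: pair_continuous; first exact: cst_continuous.
apply: (@ptws_continuous _ _ (fun=> {ptws nat -> C} : topologicalType)) => j q.
apply: (@continuous_comp _ _ _ snd (fun e : universal R r => e i)).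
  exact: snd_continuous.
exact: (@ptws_proj_continuous _ (fun=> {ptws nat -> C} : topologicalType)).
Qed.

Lemma coordinate_equivariant p t : torus t ->
  orbit_class (coordinate (diag_act t p)) = orbit_class (coordinate p).
Proof. by move=> Tt; apply/esym/orbit_classP; exists (fun=> t i) => // j; exact: Tt. Qed.

Lemma coordinate_borel x : borel [set: point_tspace r] x ->
  borel [set: point_tspace 1] (quotient_map coordinate x).
Proof.
move=> [p [_ fp] <-]; rewrite quotient_mapE; last exact: coordinate_equivariant.
by exists (coordinate p) => //; split => // j; exact: fp.
Qed.

(* Pullback to BT of a class on B C^* = CP^oo along the i-th coordinate
   character; for the Chern class of the tautological character this is the
   i-th generator of H_T(pt). *)
Definition char_class : eqcohom_pt 1 -> eqcohom_pt r :=
  pullback (quotient_map_continuous coordinate_continuous coordinate_equivariant)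
    coordinate_borel.
End Characters.
End EquivariantCohomology.


Section Grassmannian.
Variable R : realType.
Local Notation C := (cplx R).

Definition grassmannian : Type := {vspace 'cV[C]_2}.

HB.instance Definition _ := Choice.on grassmannian.

Definition column_space k (M : 'M[C]_(2, k)) : grassmannian :=
  limg (linfun (mulmx M : 'cV[C]_k -> 'cV[C]_2)).

(* The quotient topology from full-rank 2 x k matrices, on the disjoint union
   over k of the Grassmannians of k-planes in C^2. *)
Definition grassmannian_open (U : set grassmannian) : Prop :=
  forall k, exists2 O : set 'M[C]_(2, k), open O &
    forall M, \rank M = k -> O M <-> U (column_space M).

Lemma grassmannian_openT : grassmannian_open setT.
Proof. by move=> k; exists setT => //; exact: openT. Qed.

Lemma grassmannian_openI : setI_closed grassmannian_open.
Proof.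
move=> U V oU oV k; have [O oO OU] := oU k; have [Q oQ QV] := oV k.
exists (O `&` Q); first exact: openI.
by move=> M rM; split=> -[/(OU _ rM) ? /(QV _ rM) ?].
Qed.

Lemma grassmannian_open_bigcup (I : Type) (U : I -> set grassmannian) :
  (forall i, grassmannian_open (U i)) -> grassmannian_open (\bigcup_i U i).
Proof.
move=> oU k.
have /choice[O OP] : forall i, exists O : set 'M[C]_(2, k), open O /\
    forall M, \rank M = k -> O M <-> U i (column_space M).
  by move=> i; have [O oO OU] := oU i k; exists O.
exists (\bigcup_i O i); first by apply: bigcup_open => i _; case: (OP i).
by move=> M rM; split=> -[i _ H]; exists i => //; apply/((OP i).2 M rM).
Qed.

HB.instance Definition _ := isOpenTopological.Build grassmannian
  grassmannian_openT grassmannian_openI grassmannian_open_bigcup.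

End Grassmannian.

Section FlagVariety.
Variables (R : realType) (N : nat).
Local Notation C := (cplx R).

(* Pairs (V, xi) of a tuple V = (V_1, .., V_(N-1)) of subspaces of C^2, with
   V_(k+1) stored at k : 'I_N.-1, and a 2 x 2 matrix xi. *)
Definition flag_ambient : topologicalType :=
  ({ptws 'I_N.-1 -> grassmannian R} * 'M[C]_2)%type.

(* The torus T has coordinates (u_1, u_2, hbar), at indices 0, 1, 2. *)
Definition u_index (s : 'I_2) : 'I_3 := widen_ord (leqnSn 2) s.
Definition h_index : 'I_3 := ord_max.

Definition standard_rep (t : 'I_3 -> C) : 'M[C]_2 :=
  diag_mx (\row_s t (u_index s)).

Definition flag_act (t : 'I_3 -> C) (p : flag_ambient) : flag_ambient :=
  (fun k => (linfun (mulmx (standard_rep t)) @: p.1 k)%VS,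
   t h_index *: (standard_rep t *m p.2 *m invmx (standard_rep t))).

Lemma standard_rep1 : standard_rep 1 = 1%:M.
Proof. by apply/matrixP => i j; rewrite !mxE. Qed.

Lemma standard_repM s t : standard_rep (s * t) = standard_rep s *m standard_rep t.
Proof.
by rewrite mulmx_diag; congr diag_mx; apply/rowP => j; rewrite !mxE.
Qed.

Lemma standard_rep_unit t : torus t -> standard_rep t \in unitmx.
Proof.
move=> Tt; rewrite unitmxE det_diag unitfE; apply/prodf_neq0 => i _.
by rewrite mxE; exact: Tt.
Qed.

Lemma linfun_mulmxM (g h : 'M[C]_2) :
  linfun (mulmx (g *m h) : 'cV[C]_2 -> 'cV[C]_2) =
  (linfun (mulmx g) \o linfun (mulmx h))%VF.
Proof. by apply/lfunP => v; rewrite comp_lfunE !lfunE /= mulmxA. Qed.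

Lemma flag_act1 p : flag_act 1 p = p.
Proof.
case: p => V x; rewrite /flag_act standard_rep1 invmx1 mulmx1 mul1mx scale1r.
congr pair; apply/funext => k /=; rewrite (_ : linfun _ = \1%VF); first exact: lim1g.
by apply/lfunP => v; rewrite id_lfunE lfunE /= mul1mx.
Qed.

Lemma flag_actM s t p : torus s -> torus t ->
  flag_act (s * t) p = flag_act s (flag_act t p).
Proof.
move=> Ts Tt; rewrite /flag_act standard_repM; congr pair.
  by apply/funext => k; rewrite linfun_mulmxM limg_comp.
have -> : invmx (standard_rep s *m standard_rep t) =
    invmx (standard_rep t) *m invmx (standard_rep s).
  by apply: invrM; exact: standard_rep_unit.
rewrite -scalemxAr -scalemxAl scalerA /=.
by rewrite !mulmxA.
Qed.

Definition flag_tspace : tspace R 3 := TSpace flag_act1 flag_actM.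

Definition stabilizes (x : 'M[C]_2) (V : 'I_N.-1 -> grassmannian R) : bool :=
  [forall k, (linfun (mulmx x) @: V k <= V k)%VS].

(* The tangent space of the flag variety at V is gl_2 / p, with p the stabilizer
   of V in gl_2. A covector at V is thus a linear form on gl_2 that vanishes on p,
   encoded as xi through x |-> \tr (xi *m x). All dimension vectors are allowed,
   so this is the disjoint union of the cotangent bundles. *)
Definition cotangent_flags : set flag_tspace :=
  [set p : flag_ambient |
    (forall k l : 'I_N.-1, (k <= l)%N -> (p.1 l <= p.1 k)%VS) /\
    (forall x, stabilizes x p.1 -> \tr (p.2 *m x) = 0)].

Definition label (i : 'I_N * 'I_N) (s : 'I_2) : 'I_N :=
  if s == 0 then i.1 else i.2.

Definition basis_vector (s : 'I_2) : 'cV[C]_2 := delta_mx s 0.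

(* Labels are 0-based and k stands for the index k + 1, so i_s > k + 1 for
   1-based labels reads k < label i s. *)
Definition fixed_point (i : 'I_N * 'I_N) : flag_tspace :=
  ((fun k : 'I_N.-1 =>
     (\sum_(s < 2 | (k < label i s)%N) <[basis_vector s]>)%VS),
   0).

Lemma fixed_point_in i : cotangent_flags (fixed_point i).
Proof.
split=> [k l kl|x _] /=; last by rewrite mul0mx mxtrace0.
apply/subv_sumP => s ls; apply: (sumv_sup s) => //; exact: leq_ltn_trans ls.
Qed.

End FlagVariety.


Section StableMap.
Variables (R : realType) (N : nat).
Local Notation C := (cplx R).
Local Notation K := (mpoly 3 C).
Local Notation X := (@cotangent_flags R N).
Local Notation fixed := (@fixed_point R N).

Definition eqvar (i : 'I_3) : K := mpolyX C (mnm1 i).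
Definition u_var : K := eqvar (u_index 0) - eqvar (u_index 1).
Definition h_var : K := eqvar h_index.

(* H_T(pt) = C[u_1, u_2, hbar], each variable being the class of the
   corresponding character of T; c is the generator of H^2(CP^oo). *)
Definition is_char_iso (c : eqcohom_pt R 1) (phi : {rmorphism K -> eqcohom_pt R 3}) :=
  [/\ homogeneous 2 c, scalable phi, bijective phi &
      forall i, phi (eqvar i) = char_class i c].

(* The image in H_T(A) of a polynomial q, an element of H_T(pt). *)
Definition eqscalar (phi : K -> eqcohom_pt R 3) (A : set (flag_tspace R N)) (q : K) :
  eqcohom A := structure_map A (phi q).

(* Characters of T, written additively as integer vectors. *)
Definition u_char (s : 'I_2) : 'rV[int]_3 := delta_mx 0 (u_index s).
Definition h_char : 'rV[int]_3 := delta_mx 0 h_index.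

Definition linear_form (w : 'rV[int]_3) : K := \sum_i eqvar i *~ w 0 i.
Definition euler (ws : seq 'rV[int]_3) : K := \prod_(w <- ws) linear_form w.

Definition pairing (sigma : int * int) (w : 'rV[int]_3) : int :=
  w 0 (u_index 0) * sigma.1 + w 0 (u_index 1) * sigma.2.

(* T-weights of gl_2 / p at a fixed point: that of the matrix unit E_ab, for
   each E_ab that does not stabilize the flag, is u_a - u_b. *)
Definition flag_weights (i : 'I_N * 'I_N) : seq 'rV[int]_3 :=
  [seq u_char ab.1 - u_char ab.2 | ab <- enum {: 'I_2 * 'I_2} &
     ~~ @stabilizes R N (delta_mx ab.1 ab.2) (fixed i).1].

(* A fixed component is a point, and its normal space is the tangent space of
   T^*F there. *)
Definition normal_weights (i : 'I_N * 'I_N) : seq 'rV[int]_3 :=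
  flag_weights i ++ [seq h_char - w | w <- flag_weights i].

Definition euler_minus (sigma : int * int) (i : 'I_N * 'I_N) : K :=
  euler [seq w <- normal_weights i | pairing sigma w < 0].

Definition restrict_to_A (q : K) : K :=
  comp_mpoly [tuple eqvar (u_index 0); eqvar (u_index 1); 0] q.

Definition polarization (i : 'I_N * 'I_N) : K :=
  restrict_to_A (euler (flag_weights i)).

(* Degree in u_1, u_2 only; true for q = 0. *)
Definition A_degree_lt (d : nat) (q : K) : Prop :=
  forall m, m \in msupp q -> (m (u_index ord0) + m (u_index ord_max) < d)%N.

Definition cocharacter (sigma : int * int) (z : C) : 'I_3 -> C := fun i =>
  if i == u_index 0 then z ^ sigma.1
  else if i == u_index 1 then z ^ sigma.2 else 1.

Definition leaf (sigma : int * int) (i : 'I_N * 'I_N) : set (flag_tspace R N) :=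
  [set x | X x /\ flag_act (cocharacter sigma z) x @[z --> (0 : C)^'] --> fixed i].

(* leaf_order sigma i j means that i is above j. *)
Definition leaf_order (sigma : int * int) : rel ('I_N * 'I_N) :=
  connect (fun i j => `[< closure (leaf sigma i) (fixed j) >]).

Definition slope (sigma : int * int) (i : 'I_N * 'I_N) : set (flag_tspace R N) :=
  \bigcup_(j in [set j | leaf_order sigma i j]) leaf sigma j.

(* H_T(X^A), identified with C^N (x) C^N (x) C[u_1, u_2, hbar], is the space of
   matrices whose (i, j) entry is the coefficient of e_i (x) e_j. *)
Definition fixed_class (i : 'I_N * 'I_N) : 'M[K]_N := delta_mx i.1 i.2.

Lemma off_slope sigma i : X `\` slope sigma i `<=` X.
Proof. exact: subDsetl. Qed.

Lemma fixed_sub i : [set fixed i] `<=` X.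
Proof. by move=> _ ->; exact: fixed_point_in. Qed.

(* Support on a set means that the restriction to the complement vanishes. The
   bound on the A-degree is required for gamma in H_(T/A)(pt) = C[hbar], i.e. of
   A-degree 0: multiplying gamma by u_1 raises the degree of both sides. *)
Record stable_map (phi : K -> eqcohom_pt R 3) (sigma : int * int)
    (S : 'M[K]_N -> eqcohom X) : Prop := StableMap {
  stable_linear : forall q v w, S (q *: v + w) = eqscalar phi X q * S v + S w;
  stable_support : forall i gamma,
    restrict (@off_slope sigma i) (S (gamma *: fixed_class i)) = 0;
  stable_normal : forall i, exists2 s : bool,
    restrict_to_A ((-1) ^+ s * euler_minus sigma i) = polarization i &
    forall gamma, restrict (@fixed_sub i) (S (gamma *: fixed_class i)) =
      eqscalar phi [set fixed i] ((-1) ^+ s * euler_minus sigma i * gamma);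
  stable_degree : forall i gamma, A_degree_lt 1 gamma ->
    forall j, leaf_order sigma i j -> j != i ->
    exists2 q, restrict (@fixed_sub j) (S (gamma *: fixed_class i)) =
        eqscalar phi [set fixed j] q &
      A_degree_lt (size (normal_weights j))./2 q
}.

Local Notation F := {fraction K}.

(* L is the tensor product of H_T(X) with the fraction field of H_T(pt),
   with l the canonical map. *)
Definition is_localization (phi : K -> eqcohom_pt R 3) (L : lmodType F)
    (l : {additive eqcohom X -> L}) : Prop :=
  [/\ forall q x, l (eqscalar phi X q * x) = tofrac q *: l x,
      forall y, exists x q, q != 0 /\ tofrac q *: y = l x &
      forall x, l x = 0 -> exists2 q, q != 0 & eqscalar phi X q * x = 0].

(* The extension of S to the fraction field. *)
Definition localized (L : lmodType F) (l : eqcohom X -> L)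
    (S : 'M[K]_N -> eqcohom X) (v : 'M[F]_N) : L :=
  \sum_i \sum_j v i j *: l (S (fixed_class (i, j))).

End StableMap.

Section Tensor.
Variables (F : fieldType) (N : nat).

Definition tensor (x y : 'cV[F]_N) : 'M[F]_N := x *m y^T.

Definition permutation_op (v : 'M[F]_N) : 'M[F]_N := v^T.

Lemma permutation_opE x y : permutation_op (tensor x y) = tensor y x.
Proof. by rewrite /permutation_op trmx_mul trmxK. Qed.

End Tensor.


Notation eqpoly R := (mpoly 3 (cplx R)).
Notation eqfrac R := {fraction (mpoly 3 (cplx R))}.

(* Main.v *)
Require Import Defs.
From HB Require Import structures.
From mathcomp Require Import all_boot all_order all_algebra.
From mathcomp Require Import all_classical reals topology normedtype.
From mathcomp Require Import complex.
From mathcomp Require Import -(notations) mpoly.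
From mathcomp Require Import zify ring.
Set Implicit Arguments.
Unset Strict Implicit.
Unset Printing Implicit Defensive.
Import Order.TTheory GRing.Theory Num.Theory.
Import numFieldTopology.Exports numFieldNormedType.Exports.
Local Open Scope classical_set_scope.
Local Open Scope ring_scope.

(* On the component T^*P^1 with fixed points i = (a, b) and i' = (b, a), the
   restriction of Stab(e_i) to i is given by the normalization axiom, its
   restriction to i' lies in C[hbar] by the degree axiom, and both agree modulo
   u: the subtorus u_1 = u_2 fixes P^1 pointwise, so a path in P^1 from i to i' is
   a homotopy between the two inclusions of the classifying space of the subtorus
   into the Borel construction. This determines the restriction to i', without
   any knowledge of the order of i and i'; all other restrictions vanish by the
   support axiom, since dimensions are locally constant on flags. With these
   values (u + hbar) Stab_1(e_i) and u Stab_2(e_i) + hbar Stab_2(e_i') have the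
   same restrictions to all fixed points. Since Stab_2 is onto after localization
   and its restriction matrix is triangular with nonzero diagonal, a class that
   restricts to 0 at all fixed points is 0 in the localization. *)

(** * Pullbacks and homotopy invariance of singular cohomology *)

Section PullbackMorphism.
Variables (R : realType) (Z W : topologicalType) (A : set Z) (B : set W).
Variables (f : Z -> W) (cf : continuous f) (fAB : forall z, A z -> B (f z)).
Local Notation f_s := (push_simplex (R := R) cf fAB).
Local Notation "f^*" := (pullback (R := R) cf fAB).

Lemma push_simplex_face s p h : f_s (face s p h) = face (f_s s) p h.
Proof. by rewrite /push_simplex /face /=; congr existT; apply: simplexP. Qed.

Lemma pull_cup (c d : cochain R B) :
  pull_cochain cf fAB (cup c d) =
  cup (pull_cochain cf fAB c) (pull_cochain cf fAB d).
Proof.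
apply: cochainP => s; rewrite /pull_cochain /cup /=.
by apply: eq_bigr => p _; rewrite !push_simplex_face.
Qed.

Lemma pullback_zmod : zmod_morphism f^*.
Proof.
move=> x y; rewrite -[x]cohom_classK -[y]cohom_classK.
have classB (V : topologicalType) (D : set V) (c d : cocycle R D) :
    cohom_class c - cohom_class d = cohom_class (c - d).
  apply/eqP; rewrite subr_eq -cohom_classD; apply/eqP; congr cohom_class.
  by rewrite subrK.
by rewrite classB !pullbackE classB; congr cohom_class; apply/val_inj.
Qed.

HB.instance Definition _ :=
  GRing.isZmodMorphism.Build (cohomology R B) (cohomology R A) f^* pullback_zmod.

Lemma pullback_monoid : monoid_morphism f^*.
Proof.
split=> [|x y].
  by rewrite pullbackE; congr cohom_class; apply/val_inj.
rewrite -[x]cohom_classK -[y]cohom_classK.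
rewrite [X in f^* X](cohom_mulE (repr x) (repr y)) !pullbackE.
rewrite [RHS]cohom_mulE; congr cohom_class.
by apply/val_inj; exact: pull_cup.
Qed.

HB.instance Definition _ :=
  GRing.isMonoidMorphism.Build (cohomology R B) (cohomology R A) f^* pullback_monoid.

Lemma pullback_scalable : scalable f^*.
Proof.
move=> a x; rewrite -[x]cohom_classK [X in f^* X](cohom_scaleE a (repr x)).
by rewrite !pullbackE [RHS]cohom_scaleE; congr cohom_class; apply/val_inj.
Qed.

End PullbackMorphism.

(** The composite is a separate map [h], compared with [g] after [f] only on [A]: simplices of [A]
    take their values there. Continuity and stability proofs for [h] thus stay arbitrary. *)
Lemma pullback_comp (R : realType) (Z W V : topologicalType)
    (A : set Z) (B : set W) (D : set V)
    (f : Z -> W) (cf : continuous f) (fAB : forall z, A z -> B (f z))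
    (g : W -> V) (cg : continuous g) (gBD : forall w, B w -> D (g w))
    (h : Z -> V) (ch : continuous h) (hAD : forall z, A z -> D (h z)) :
  (forall z, A z -> g (f z) = h z) ->
  forall x : cohomology R D,
    pullback cf fAB (pullback cg gBD x) = pullback ch hAD x.
Proof.
move=> gf x; rewrite -[x]cohom_classK !pullbackE; congr cohom_class.
apply/val_inj/cochainP => s /=; rewrite /pull_cochain /=; congr (cocycle_val _ _).
rewrite /push_simplex /=; congr existT; apply: simplexP => y /=; apply: gf.
exact: (proj2_sig (tagged s)).2.
Qed.

Lemma spush_comp (R : realType) p q n (h : 'I_q.+1 -> 'I_n.+1)
    (k : 'I_p.+1 -> 'I_q.+1) x :
  @spush R q n h (spush k x) = spush (h \o k) x.
Proof.
apply/val_inj/funext => j /=; rewrite /push.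
rewrite [RHS](partition_big k (fun i => h i == j)) //=.
apply: eq_bigr => i /eqP hij; apply: eq_bigl => l /=.
by case: eqP => [->|]; rewrite ?andbF // hij eqxx.
Qed.

Lemma spush_id (R : realType) n (h : 'I_n.+1 -> 'I_n.+1) x :
  h =1 id -> @spush R n n h x = x.
Proof.
move=> hE; apply/val_inj/funext => j /=; rewrite /push.
by rewrite (big_pred1 j) // => i; rewrite hE.
Qed.

(* The cancellation pattern of the prism operator: the diagonals of F telescope,
   the two triangles of F cancel those of G. *)
Lemma prism_cancellation (V : zmodType) (n : nat) (F G : nat -> nat -> V)
    (T : nat -> V) :
  (forall i, F i i = T i) -> (forall i, F i i.+1 = - T i.+1) ->
  (forall i j, (j <= i)%N -> F i.+1 j = - G i j) ->
  (forall i j, (i < j)%N -> F i j.+1 = - G i j) ->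
  \sum_(0 <= i < n.+1) \sum_(0 <= j < n.+2) F i j +
  \sum_(0 <= i < n) \sum_(0 <= j < n.+1) G i j = T 0 - T n.+1.
Proof.
move=> Fii FiS FS FG.
(* In row [i] the columns [i] and [i.+1] are split off and give [T i - T i.+1], which telescopes;
   the triangles [j < i] and [j > i.+1] remain. *)
rewrite (eq_big_nat _ _ (F2 := fun i => (T i - T i.+1) +
  (\sum_(0 <= j < i) F i j + \sum_(i.+2 <= j < n.+2) F i j))); last first.
  move=> i /andP[_ ilt].
  rewrite (big_cat_nat (n := i)) //=; last by lia.
  rewrite [X in _ + X]big_ltn; last by lia.
  rewrite [X in _ + (_ + X)]big_ltn; last by lia.
  by rewrite Fii FiS addrCA !addrA (addrAC (T i)).
rewrite big_split /= (telescope_sumr_eq (fun i => - T i)) //; last first.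
  by move=> i _; rewrite opprK addrC.
rewrite opprK (addrC (- _)) -addrA -[RHS]addr0; congr +%R; rewrite big_split /=.
(* A shift of the row index turns the lower triangle into the part [j <= i] of [G]; below, a shift
   of the column index turns the upper one into the part [i < j]. *)
have -> : \sum_(0 <= i < n.+1) \sum_(0 <= j < i) F i j =
    - \sum_(0 <= i < n) \sum_(0 <= j < i.+1) G i j.
  rewrite big_nat_recl //= [X in X + _]big_geq // add0r -sumrN.
  apply: eq_big_nat => i _; rewrite -sumrN; apply: eq_big_nat => j /andP[_ ji]; exact: FS.
have -> : \sum_(0 <= i < n.+1) \sum_(i.+2 <= j < n.+2) F i j =
    - \sum_(0 <= i < n) \sum_(i.+1 <= j < n.+1) G i j.
  rewrite big_nat_recr //= [X in _ + X]big_geq // addr0 -sumrN.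
  apply: eq_big_nat => i _; rewrite big_add1 -sumrN.
  by apply: eq_big_nat => j /andP[ij _]; exact: FG.
rewrite -opprD -big_split /= addrC; apply/eqP; rewrite subr_eq0; apply/eqP.
apply: eq_big_nat => i /andP[_ ilt].
by rewrite (big_cat_nat (n := i.+1) (p := n.+1)) //=; lia.
Qed.

(** * Homotopy invariance by the prism operator *)

Section Homotopy.
Variables (R : realType) (Z W : topologicalType) (A : set Z) (B : set W).
Variables (H : R * Z -> W) (cH : continuous H).
Hypothesis HAB : forall t z, A z -> B (H (t, z)).

(* The restriction of the homotopy to a simplex of the prism R x s, where
   vertex k lies over vertex h k of s, at height theta k. *)
Definition prism_map (s : anysimplex R A) (m : nat) (h : nat -> nat)
    (theta : nat -> bool) (x : set_type (@stdsimplex R m)) : W :=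
  H (\sum_(k < m.+1 | theta k) set_val x k,
     sval (tagged s) (spush (fun k : 'I_m.+1 => inord (h k)) x)).

Lemma prism_subproof s m h theta :
  continuous (@prism_map s m h theta) /\ forall x, B (@prism_map s m h theta x).
Proof.
split=> [|x]; last by apply: HAB; exact: (proj2_sig (tagged s)).2.
move=> x; apply: (@continuous_comp _ _ _ (fun x : set_type (@stdsimplex R m) =>
  (\sum_(k < m.+1 | theta k) set_val x k : R,
   sval (tagged s) (spush (fun k : 'I_m.+1 => inord (h k)) x))) H); last exact: cH.
move: x; apply: pair_continuous => x.
  apply: (@continuous_comp _ _ _ set_val
    (fun y : {ptws 'I_m.+1 -> R} => \sum_(k < m.+1 | theta k) y k)).
    exact: initial_continuous.
  apply: (@continuous_big R _ +%R 0 (fun k : 'I_m.+1 => theta k) (@add_continuous R)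
    {ptws 'I_m.+1 -> R} _ (fun k x => x k)) => k _.
  exact: (@ptws_proj_continuous _ (fun=> R : topologicalType)).
apply: continuous_comp; first exact: spush_continuous.
exact: (proj2_sig (tagged s)).1.
Qed.

Definition prism s m h theta : anysimplex R B :=
  existT _ m (exist _ _ (prism_subproof s m h theta) : simplex R B m).

Lemma eq_prism s m h k theta eta :
  (forall i, (i <= m)%N -> h i = k i) ->
  (forall i, (i <= m)%N -> theta i = eta i) ->
  prism s m h theta = prism s m k eta.
Proof.
move=> hk te; rewrite /prism; congr existT; apply: simplexP => x /=.
rewrite /prism_map; congr H; congr pair.
  by apply: eq_bigl => i; rewrite te // -ltnS.
by congr (sval _ (spush _ x)); apply/funext => i; rewrite hk // -ltnS.
Qed.

Lemma prism_face s p m (h k : nat -> nat) theta : (forall i, (i <= m)%N -> (h i <= p)%N) ->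
  prism (face s p k) m h theta = prism s m (k \o h) theta.
Proof.
move=> hp; rewrite /prism; congr existT; apply: simplexP => x /=.
rewrite /prism_map /=; congr H; congr pair; rewrite spush_comp.
by congr (sval _ (spush _ x)); apply/funext => i /=; rewrite inordK // ltnS hp // -ltnS.
Qed.

Lemma face_prism s m p (h k : nat -> nat) theta : (forall i, (i <= p)%N -> (k i <= m)%N) ->
  face (prism s m h theta) p k = prism s p (h \o k) (theta \o k).
Proof.
move=> km; rewrite /face /prism /=; congr existT; apply: simplexP => x /=.
have kK (i : 'I_p.+1) : (inord (k i) : 'I_m.+1) = k i :> nat.
  by rewrite inordK // ltnS km // -ltnS.
rewrite /prism_map /=; congr H; congr pair.
  rewrite /push [RHS](partition_big (fun i : 'I_p.+1 => inord (k i) : 'I_m.+1)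
    (fun i => theta i)) /=; last by move=> i; rewrite kK.
  apply: eq_bigr => i ti; apply: eq_bigl => l.
  by case: eqP => [li|]; rewrite ?andbF // -kK li ti.
by rewrite spush_comp; congr (sval _ (spush _ x)); apply/funext => i /=; rewrite kK.
Qed.

Lemma homotopy_end_continuous t : continuous (fun z => H (t, z)).
Proof.
move=> z; apply: (@continuous_comp _ _ _ (fun z => (t, z)) H); last exact: cH.
by move: z; apply: pair_continuous; [exact: cst_continuous|exact: id_continuous].
Qed.

Local Notation end_simplex t := (push_simplex (@homotopy_end_continuous t) (HAB t)).

(** With constant [theta] the height is the sum of all barycentric coordinates, which is 1, or the
    empty sum. *)
Lemma prism_end s (b : bool) :
  prism s (tag s) id (fun=> b) = end_simplex b%:R s.
Proof.
rewrite /prism /push_simplex; congr existT; apply: simplexP => x /=.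
rewrite /prism_map spush_id => [|i]; last by rewrite inord_val.
congr H; congr pair; case: b => /=; last by rewrite big_pred0.
by have [] := set_valP x.
Qed.

(** The monotone surjection that takes the value [i] twice, at [i] and [i.+1]. With heights [i < k]
    it describes the prism piece with vertices 0, .., i at the bottom and i, .., n at the top. *)
Definition degeneracy (i k : nat) : nat := (k - (i < k))%N.

Definition prism_operator (c : cochain R B) : cochain R A := fun s =>
  \sum_(0 <= i < (tag s).+1)
    (-1) ^+ i * c (prism s (tag s).+1 (degeneracy i) (fun k => (i < k)%N)).

(** Faces [i] and [i.+1] of piece [i] are shared with neighbouring pieces or are ends of the prism;
    every other face is a piece of the prism over a face of [s]. These are the hypotheses of
    [prism_cancellation]. *)
Lemma prism_operatorE c : coboundary (prism_operator c) =
  pull_cochain (@homotopy_end_continuous 1) (HAB 1) c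
  - pull_cochain (@homotopy_end_continuous 0) (HAB 0) c
  - prism_operator (coboundary c).
Proof.
apply: cochainP => s; apply/eqP; rewrite eq_sym subr_eq eq_sym addrC; apply/eqP.
set n := tag s.
(* [F] collects the faces of the pieces, [G] the pieces over the faces of [s], and [T i] the wall
   whose vertices from [i] on are at height 1. *)
pose F i j := (-1) ^+ (i + j) * c (prism s n (degeneracy i \o bump j)
  ((fun k => i < k)%N \o bump j)).
pose G i j := (-1) ^+ (i + j) * c (prism s n (bump j \o degeneracy i)
  (fun k => i < k)%N).
pose T i := c (prism s n id (fun k => i <= k)%N).
have -> : (coboundary (prism_operator c)) s =
    \sum_(0 <= i < n) \sum_(0 <= j < n.+1) G i j.
  rewrite /coboundary /prism_operator /G /n; case: (tag s) => [|m] /=.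
    by rewrite big_geq.
  rewrite exchange_big /= big_mkord; apply: eq_bigr => j _; rewrite mulr_sumr.
  apply: eq_big_nat => i /andP[_ im]; rewrite mulrA -exprD addnC prism_face // => k km.
  by rewrite /degeneracy; lia.
have -> : prism_operator (coboundary c) s =
    \sum_(0 <= i < n.+1) \sum_(0 <= j < n.+2) F i j.
  rewrite /prism_operator; apply: eq_bigr => i _; rewrite /coboundary /= mulr_sumr.
  rewrite big_mkord; apply: eq_bigr => j _; rewrite mulrA -exprD.
  by rewrite face_prism // => k kn; rewrite /bump; lia.
rewrite (@prism_cancellation _ _ F G T).
(* No vertex index reaches [n.+1], so this wall is the bottom end; [T 0] is the top end. *)
- have -> : T n.+1 = c (prism s n id (fun=> false)).
    by congr (c _); apply: eq_prism => // k; rewrite leqNgt => /negbTE.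
  by rewrite /T (prism_end s true) (prism_end s false).
- move=> i; rewrite /F /T addnn -mul2n exprM sqrrN !expr1n mul1r.
  by congr (c _); apply: eq_prism => k _ /=; rewrite /degeneracy /bump; lia.
- move=> i; rewrite /F /T addnS addnn exprS -mul2n exprM sqrrN !expr1n mulr1 mulN1r.
  by congr (- c _); apply: eq_prism => k _ /=; rewrite /degeneracy /bump; lia.
- move=> i j ij; rewrite /F /G addSn exprS mulN1r mulNr.
  by congr (- (_ * c _)); apply: eq_prism => k _ /=; rewrite /degeneracy /bump; lia.
- move=> i j ij; rewrite /F /G addnS exprS mulN1r mulNr.
  by congr (- (_ * c _)); apply: eq_prism => k _ /=; rewrite /degeneracy /bump; lia.
Qed.

(** On a cocycle the term [prism_operator (coboundary _)] vanishes, so the two pullbacks differ by a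
    coboundary. The prism operator evaluates a cochain one degree higher, hence preserves a degree
    bound. *)
Lemma homotopy_invariance x :
  pullback (R := R) (@homotopy_end_continuous 0) (HAB 0) x =
  pullback (@homotopy_end_continuous 1) (HAB 1) x.
Proof.
rewrite -[x]cohom_classK !pullbackE; apply/esym/cohom_classP/asboolP.
have [[M cM] dc] := cocycleP (repr x).
exists (prism_operator (repr x)).
  exists M => s Ms; rewrite /prism_operator big1 // => i _.
  by rewrite cM ?mulr0 //=; lia.
rewrite prism_operatorE dc (_ : prism_operator 0 = 0) ?subr0 //.
by apply: cochainP => s; rewrite /prism_operator big1 // => i _; rewrite mulr0.
Qed.

End Homotopy.

(** * Equivariant classes at a point fixed by a subtorus *)

Lemma eq_pullback (R : realType) (Z W : topologicalType) (A : set Z) (B : set W)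
    (f g : Z -> W) (cf : continuous f) (cg : continuous g)
    (fAB : forall z, A z -> B (f z)) (gAB : forall z, A z -> B (g z)) :
  (forall z, A z -> f z = g z) ->
  forall x : cohomology R B, pullback cf fAB x = pullback cg gAB x.
Proof.
move=> fg x; rewrite /pullback; congr cohom_class.
apply/val_inj/cochainP => s /=; rewrite /pull_cochain /=; congr (cocycle_val _ _).
rewrite /push_simplex /=; congr existT; apply: simplexP => y /=; apply: fg.
exact: (proj2_sig (tagged s)).2.
Qed.

(** The preimage of the image of [B] is the union of the preimages of [B] under all torus elements,
    each open because every element acts continuously. *)
Lemma orbit_class_open (R : realType) (r : nat) (Y : tspace R r)
    (B : set (Y * universal R r)) :
  (forall t, torus t -> continuous (@tact R r Y t)) -> open B ->
  open (@orbit_class R r Y @` B).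
Proof.
move=> ct oB.
have ctE t : torus t -> continuous (@diag_act R r Y t).
  move=> Tt; apply: pair_continuous => p.
    apply: (@continuous_comp _ _ _ fst (tact t)); last exact: ct.
    exact: (@cvg_fst _ _ (nbhs p.1) (nbhs p.2)).
  apply: (@continuous_comp _ _ _ snd (universal_act t)).
    exact: snd_continuous.
  move: {p}(p.2).
  apply: (@ptws_continuous _ _ (fun=> {ptws nat -> cplx R} : topologicalType)) => i.
  apply: (@ptws_continuous _ _ (fun=> cplx R : topologicalType)) => n p.
  apply: (@continuousM (cplx R) _ (cst (t i)) (fun e : universal R r => e i n)).
    exact: cst_continuous.
  apply: (@continuous_comp _ _ _ (fun e : universal R r => e i)
    (fun a : {ptws nat -> cplx R} => a n)).
    exact: (@ptws_proj_continuous _ (fun=> {ptws nat -> cplx R} : topologicalType)).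
  exact: (@ptws_proj_continuous _ (fun=> cplx R : topologicalType)).
rewrite (_ : open _ = open (@orbit_class R r Y @^-1` (@orbit_class R r Y @` B))) //.
rewrite (_ : _ @^-1` _ = \bigcup_(t in @torus R r) (diag_act t @^-1` B)).
  by apply: bigcup_open => t Tt; apply: open_comp => // p _; exact: ctE.
apply/seteqP; split=> [p [q Bq /esym/orbit_classP[t Tt qE]]|p [t Tt Bt]].
  by exists t => //=; rewrite -qE.
by exists (diag_act t p) => //; apply/esym/orbit_classP; exists t.
Qed.

Section PointInclusion.
Variables (R : realType) (r : nat) (Y : tspace R r).
Variables (A : set Y) (pi : 'I_r -> 'I_r).

(** The reindexing [pi] encodes the torus endomorphism t |-> t o pi, so a subtorus is treated as the
    image of the whole torus. The map is equivariant along this endomorphism as soon as its image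
    fixes [y]. *)
Definition point_map (y : Y) (p : point_tspace R r * universal R r) :
  Y * universal R r := (y, fun i => p.2 (pi i)).

Lemma universal_reindex_continuous :
  continuous (fun e : universal R r => (fun i => e (pi i)) : universal R r).
Proof.
apply: (@ptws_continuous _ _ (fun=> {ptws nat -> cplx R} : topologicalType)) => i.
exact: (@ptws_proj_continuous _ (fun=> {ptws nat -> cplx R} : topologicalType)).
Qed.

Lemma point_map_continuous y : continuous (point_map y).
Proof.
apply: pair_continuous; first exact: cst_continuous.
move=> p; apply: (@continuous_comp _ _ _ snd
  (fun e : universal R r => (fun i => e (pi i)) : universal R r)).
  exact: snd_continuous.
exact: universal_reindex_continuous.
Qed.

Definition point_fixed (y : Y) := forall t, torus t -> tact (fun i => t (pi i)) y = y.

Lemma point_map_equivariant y : point_fixed y -> forall p t, torus t ->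
  orbit_class (point_map y (diag_act t p)) = orbit_class (point_map y p).
Proof.
move=> yfix p t Tt; apply/esym/orbit_classP; exists (fun i => t (pi i)) => [i|].
  exact: Tt.
by rewrite /diag_act /= yfix.
Qed.

Lemma point_map_borel y : point_fixed y -> A y ->
  forall x, borel [set: point_tspace R r] x -> borel A (quotient_map (point_map y) x).
Proof.
move=> yfix Ay x [p [_ fp] <-].
rewrite quotient_mapE; last exact: point_map_equivariant.
by exists (point_map y p) => //; split => // i; exact: fp.
Qed.

Definition point_pullback y (yfix : point_fixed y) (Ay : A y) :
    eqcohom A -> eqcohom_pt R r :=
  pullback (quotient_map_continuous (@point_map_continuous y) (point_map_equivariant yfix))
    (point_map_borel yfix Ay).


Variable y : R -> Y.
Hypotheses (cy : continuous y) (yfix : forall t, point_fixed (y t)).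
Hypothesis yA : forall t, A (y t).

Definition path_homotopy (p : R * homotopy_quotient (point_tspace R r)) :
  homotopy_quotient Y := quotient_map (point_map (y p.1)) p.2.

(* The product of R with the quotient map is again a quotient map because the
   orbit projection is open. *)
Lemma path_homotopy_continuous : continuous path_homotopy.
Proof.
case=> t x V; rewrite /path_homotopy /= -[x]reprK -/(orbit_class _).
set q := repr x; rewrite quotient_mapE; last exact: point_map_equivariant.
move=> nV.
pose g (p : R * (point_tspace R r * universal R r)) :=
  orbit_class (point_map (y p.1) p.2).
have cg : continuous g.
  move=> p; apply: (@continuous_comp _ _ _ (fun p : R * (point_tspace R r * universal R r) =>
    point_map (y p.1) p.2) (@orbit_class R r Y)); last exact: orbit_class_continuous.
  move: p; apply: pair_continuous => p.
    apply: (@continuous_comp _ _ _ fst y); last exact: cy.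
    exact: (@cvg_fst _ _ (nbhs p.1) (nbhs p.2)).
  apply: (@continuous_comp _ _ _ snd
    (fun q : point_tspace R r * universal R r => (fun i => q.2 (pi i)) : universal R r)).
    exact: snd_continuous.
  apply: (@continuous_comp _ _ _ snd
    (fun e : universal R r => (fun i => e (pi i)) : universal R r)).
    exact: snd_continuous.
  exact: universal_reindex_continuous.
(* Before passing to orbits, [g] maps a box [P] times [Q] into [V]; the image of an open part of [Q]
   is a neighbourhood of the orbit by [orbit_class_open]. *)
have [[P Q] /= [nP nQ] PQ] := cg (t, q) _ nV.
exists (P, @orbit_class R r (point_tspace R r) @` Q) => [|[s _] [/= Ps [p Qp <-]]]; last first.
  rewrite /= quotient_mapE; last exact: point_map_equivariant.
  exact: (PQ (s, p)).
split=> //=; have [O [oO Oq] OQ] : exists2 O, open_nbhs q O & O `<=` Q.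
  pose T : topologicalType := (point_tspace R r * universal R r)%type.
  by have := nQ : @nbhs T T q Q; rewrite nbhsE.
rewrite nbhsE; exists (@orbit_class R r (point_tspace R r) @` O); last exact: image_subset.
split; last by exists q.
by apply: orbit_class_open => // u _; exact: id_continuous.
Qed.

Lemma point_pullback_path x :
  point_pullback (yfix 0) (yA 0) x = point_pullback (yfix 1) (yA 1) x.
Proof.
have HA t z : borel [set: point_tspace R r] z -> borel A (path_homotopy (t, z)).
  exact: point_map_borel.
have := homotopy_invariance path_homotopy_continuous HA x.
(* The ends of the homotopy are the maps induced by [y 0] and [y 1]; only the continuity and
   stability proofs differ. *)
rewrite (eq_pullback _ (quotient_map_continuous (@point_map_continuous (y 0))
  (point_map_equivariant (yfix 0))) _ (point_map_borel (yfix 0) (yA 0))) //.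
by rewrite [RHS](eq_pullback _ (quotient_map_continuous (@point_map_continuous (y 1))
  (point_map_equivariant (yfix 1))) _ (point_map_borel (yfix 1) (yA 1))).
Qed.

End PointInclusion.

Section PointPullback.
Variables (R : realType) (r : nat).

Lemma point_tspace_fixed (pi : 'I_r -> 'I_r) : point_fixed pi (tt : point_tspace R r).
Proof. by []. Qed.

(* Pullback along the self-map of BT induced by the endomorphism t |-> t o pi. *)
Definition bt_pullback (pi : 'I_r -> 'I_r) : eqcohom_pt R r -> eqcohom_pt R r :=
  point_pullback (point_tspace_fixed pi) (I : [set: point_tspace R r] tt).

Lemma bt_pullback_id x : bt_pullback id x = x.
Proof.
rewrite /bt_pullback /point_pullback -[x in LHS]cohom_classK pullbackE -[RHS]cohom_classK.
congr cohom_class; apply/val_inj/cochainP => s /=; congr (cocycle_val _ _).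
case: s => n [s [cs sA]]; rewrite /push_simplex /=; congr existT.
apply: simplexP => z /=; have [[[] e] _ <-] := sA z.
by rewrite quotient_mapE // => p t Tt; exact: point_map_equivariant.
Qed.

Variable Y : tspace R r.

Lemma point_pullback_restrict (pi : 'I_r -> 'I_r) (A B : set Y) (AB : A `<=` B)
    y (yfix : point_fixed pi y) (Ay : A y) (By : B y) x :
  point_pullback yfix Ay (Defs.restrict AB x) = point_pullback yfix By x.
Proof. exact: pullback_comp. Qed.

Lemma point_pullback_structure (pi : 'I_r -> 'I_r) (A : set Y)
    y (yfix : point_fixed pi y) (Ay : A y) x :
  point_pullback yfix Ay (structure_map A x) = bt_pullback pi x.
Proof.
apply: pullback_comp => z [p _ <-]; rewrite !quotient_mapE //.
all: by move=> q t Tt; (exact: to_point_equivariant || exact: point_map_equivariant).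
Qed.

(** Passes from the full restriction at a torus-fixed point to its restriction to a subtorus, where
    a path through points fixed only by the subtorus can be used. *)
Lemma bt_pullback_point_pullback (pi : 'I_r -> 'I_r) (A : set Y)
    y (yfix : point_fixed id y) (yfix' : point_fixed pi y) (Ay : A y) x :
  bt_pullback pi (point_pullback yfix Ay x) = point_pullback yfix' Ay x.
Proof.
apply: pullback_comp => z [p _ <-]; rewrite !quotient_mapE //.
all: by move=> q t Tt; exact: point_map_equivariant.
Qed.

Lemma bt_pullback_char_class (pi : 'I_r -> 'I_r) i c :
  bt_pullback pi (char_class i c) = char_class (pi i) c.
Proof.
apply: pullback_comp => z [p _ <-]; rewrite !quotient_mapE //.
all: by move=> q t Tt; (exact: coordinate_equivariant || exact: point_map_equivariant).
Qed.

End PointPullback.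

(** * Flags in the plane *)

Section CoordinateSubspaces.
Variable R : realType.
Local Notation C := (cplx R).

Lemma basis_vectorE (a s : 'I_2) j : basis_vector R a s j = (s == a)%:R.
Proof. by rewrite mxE ord1 andbT. Qed.

Lemma mem_coordinate_space (P : pred 'I_2) (v : 'cV[C]_2) :
  (v \in (\sum_(s < 2 | P s) <[basis_vector R s]>)%VS) =
  [forall s, ~~ P s ==> (v s 0 == 0)].
Proof.
apply/memv_sumP/forallP => [[w wV ->] s|v0].
  apply/implyP => Ps; rewrite summxE big1 // => i Pi.
  have /vlineP[k ->] := wV i Pi; rewrite !mxE eqxx andbT.
  by case: eqP => [si|]; rewrite ?mulr0 //; rewrite si Pi in Ps.
exists (fun s => v s 0 *: basis_vector R s) => [s _|].
  by rewrite memvZ // memv_line.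
apply/matrixP => s j; rewrite (ord1 j) summxE.
rewrite big_mkcond (bigD1 s) //= big1 ?addr0 => [|k ks]; last first.
  by case: ifP => // _; rewrite !mxE eq_sym (negPf ks) mulr0.
by have := v0 s; case: ifP => [|_ /eqP] //; rewrite !mxE !eqxx mulr1.
Qed.

Lemma dim_coordinate_space (P : pred 'I_2) :
  \dim (\sum_(s < 2 | P s) <[basis_vector R s]>)%VS = (P 0%R + P 1%R)%N.
Proof.
have bN0 s : basis_vector R s != 0.
  by apply/eqP => /matrixP/(_ s 0)/eqP; rewrite !mxE !eqxx oner_eq0.
rewrite big_mkcond big_ord_recl big_ord1 /=.
rewrite (_ : lift ord0 ord0 = 1); last exact/val_inj.
case: (P _); case: (P _); rewrite ?add0v ?addv0 ?dimv0 ?dim_vline ?bN0 //.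
rewrite dimv_disjoint_sum ?dim_vline ?bN0 //; apply/eqP; rewrite -subv0.
apply/subvP => v; rewrite memv_cap => /andP[/vlineP[k ->] /vlineP[l /matrixP/(_ 0 0)]].
by rewrite !mxE !eqxx mulr1 mulr0 => ->; rewrite scale0r mem0v.
Qed.

Lemma limg_scale (a : C) (V : {vspace 'cV[C]_2}) (M : 'M[C]_2) :
  a != 0 -> M = a%:M -> (linfun (mulmx M) @: V)%VS = V.
Proof.
move=> a0 ->; apply/vspaceP => v; apply/memv_imgP/idP => [[w wV ->]|vV].
  by rewrite lfunE /= mul_scalar_mx memvZ.
exists (a^-1 *: v); first exact: memvZ.
by rewrite lfunE /= mul_scalar_mx scalerA mulfV // scale1r.
Qed.

Lemma limg_standard_rep (t : 'I_3 -> C) (P : pred 'I_2) : torus t ->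
  (linfun (mulmx (standard_rep t)) @: \sum_(s < 2 | P s) <[basis_vector R s]>)%VS =
  (\sum_(s < 2 | P s) <[basis_vector R s]>)%VS.
Proof.
move=> Tt; rewrite limg_sum; apply: eq_bigr => s _; rewrite limg_line lfunE /=.
have -> : standard_rep t *m basis_vector R s = t (u_index s) *: basis_vector R s.
  rewrite mul_diag_mx; apply/matrixP => i j; rewrite !mxE.
  by case: eqP => [->|]; rewrite ?mulr0.
apply/eqP; rewrite eqEsubv; apply/andP; split; rewrite -memvE.
  by rewrite memvZ // memv_line.
by rewrite -[X in X \in _](scalerK (Tt (u_index s))) memvZ // memv_line.
Qed.

Lemma dim_column_space k (M : 'M[C]_(2, k)) : \rank M = k -> \dim (column_space M) = k.
Proof.
move=> rM; have rfM : row_free M^T by rewrite /row_free mxrank_tr rM.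
rewrite limg_dim_eq ?dimvf /dim /= ?mul1n ?muln1 //.
apply/eqP; rewrite capfv -subv0; apply/subvP => v; rewrite memv_ker memv0 lfunE /=.
move=> /eqP Mv; apply/eqP/trmx_inj/(row_free_inj rfM).
by rewrite -!trmx_mul Mv mulmx0.
Qed.

(** Openness is tested separately on rank [k] matrices with [k] columns, whose column spaces all
    have dimension [k]: the test set is everything for [k = d] and empty otherwise. *)
Lemma open_dim (d : nat) : open [set V : grassmannian R | \dim V = d].
Proof.
move=> k; have [<-|kd] := eqVneq k d.
  by exists setT => [|M rM]; [exact: openT|split=> // _; exact: dim_column_space].
exists set0 => [|M rM]; first exact: open0.
by split=> //; rewrite /= dim_column_space // => /eqP; rewrite (negPf kd).
Qed.

End CoordinateSubspaces.

Section FixedPoints.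
Variables (R : realType) (N : nat).
Local Notation C := (cplx R).
Local Notation fixed := (@fixed_point R N).

Lemma fixed_point_fixed i : point_fixed id (fixed i).
Proof.
move=> t Tt; rewrite /= /flag_act /= mulmx0 mul0mx scaler0; congr pair.
by apply/funext => k; exact: limg_standard_rep.
Qed.

(** The matrix unit sends the basis vector [b] to the basis vector [a] and kills the other one. It
    fails to preserve a step exactly when that step contains [b] but not [a]. *)
Lemma stabilizes_delta_mx (i : 'I_N * 'I_N) (a b : 'I_2) :
  stabilizes (delta_mx a b) (fixed i).1 = (label i b <= label i a)%N.
Proof.
have deltaE (v : 'cV[C]_2) s : (linfun (mulmx (delta_mx a b)) v) s 0 = (s == a)%:R * v b 0.
  rewrite lfunE /= mxE (bigD1 b) //= big1 ?addr0 => [|k kb]; last first.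
    by rewrite mxE (negPf kb) andbF mul0r.
  by rewrite mxE eqxx andbT.
apply/forallP/idP => [st|ba k].
  rewrite leqNgt; apply/negP => ab.
  (* The violating step has index [label i a], the first one without the basis vector [a]. *)
  have kN : (label i a < N.-1)%N by have := ltn_ord (label i b); lia.
  have bV : basis_vector R b \in (fixed i).1 (Ordinal kN).
    rewrite mem_coordinate_space; apply/forallP => s; apply/implyP => /=.
    by rewrite basis_vectorE; have [->|_] := eqVneq s b; rewrite ?ab.
  have /subvP/(_ _ (memv_img _ bV)) := st (Ordinal kN).
  rewrite mem_coordinate_space => /forallP/(_ a).
  by rewrite /= ltnn /= deltaE basis_vectorE !eqxx mul1r oner_eq0.
apply/subvP => _ /memv_imgP[v + ->]; rewrite !mem_coordinate_space => /forallP vV.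
apply/forallP => s; apply/implyP => ks; rewrite deltaE.
have [sa|_] := eqVneq s a; last by rewrite mul0r.
by have := vV b; rewrite mul1r -leqNgt (leq_trans ba) // leqNgt -sa.
Qed.

Lemma fixed_point_dim i k :
  \dim ((fixed i).1 k) = ((k < i.1) + (k < i.2))%N.
Proof. by rewrite dim_coordinate_space. Qed.

Definition swap (i : 'I_N * 'I_N) := (i.2, i.1).

(** The dimension at [k] counts the labels above [k], and these counts determine the unordered pair
    of labels. *)
Lemma same_dim_swap (i j : 'I_N * 'I_N) :
  (forall k, \dim ((fixed i).1 k) = \dim ((fixed j).1 k)) -> j = i \/ j = swap i.
Proof.
move=> dij.
(* From [N.-1] on both counts are 0, so the equation extends to all natural numbers. *)
have d k : ((k < i.1) + (k < i.2) = (k < j.1) + (k < j.2))%N.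
  have [kN|Nk] := ltnP k N.-1; first by have := dij (Ordinal kN); rewrite !fixed_point_dim.
  by have := ltn_ord i.1; have := ltn_ord i.2; have := ltn_ord j.1;
     have := ltn_ord j.2; lia.
case: i j {dij} d => [[a ?] [b ?]] [[c ?] [e ?]] /= d.
(* The count is 0 exactly from the maximum on and at most 1 exactly from the minimum on. *)
have maxE : maxn a b = maxn c e.
  by have := d (maxn a b); have := d (maxn c e); lia.
have minE : minn a b = minn c e.
  by have := d (minn a b); have := d (minn c e); lia.
have [] : (c = a /\ e = b) \/ (c = b /\ e = a).
- by clear -maxE minE; lia.
- by case=> ca eb; left; congr pair; exact/val_inj.
- by case=> cb ea; right; congr pair; exact/val_inj.
Qed.

End FixedPoints.

(** * Leaves, the order on fixed points, and dimension vectors *)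

Section LeafOrder.
Variables (R : realType) (N : nat) (sigma : int * int).
Local Notation C := (cplx R).
Local Notation fixed := (@fixed_point R N).

Definition flag_dim (p : flag_tspace R N) (k : 'I_N.-1) : nat :=
  \dim ((p : flag_ambient R N).1 k).

Lemma open_flag_dim k (d : nat) : open [set p | flag_dim p k = d].
Proof.
apply: (@open_comp _ _ (fun p : flag_ambient R N => p.1 k) [set V | \dim V = d]).
  move=> p _.
  apply: (@continuous_comp _ _ _ fst (fun V : {ptws 'I_N.-1 -> grassmannian R} => V k)).
    exact: (@cvg_fst _ _ (nbhs p.1) (nbhs p.2)).
  exact: (@ptws_proj_continuous _ (fun=> grassmannian R : topologicalType)).
exact: open_dim.
Qed.

Lemma flag_dim_act t p k : torus t -> flag_dim (flag_act t p) k = flag_dim p k.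
Proof.
move=> Tt; rewrite /flag_dim /= limg_dim_eq //; apply/eqP; rewrite -subv0.
apply/subvP => v; rewrite memv_cap => /andP[_]; rewrite memv_ker memv0 lfunE /=.
move=> /eqP tv; rewrite -[v]mul1mx -(mulVmx (standard_rep_unit Tt)) -mulmxA tv.
by rewrite mulmx0.
Qed.

Lemma cocharacter_torus (z : C) : z != 0 -> torus (cocharacter sigma z).
Proof.
move=> z0 i; rewrite /cocharacter.
by case: ifP => _; [|case: ifP => _]; rewrite ?expfz_neq0 ?oner_neq0.
Qed.

(** The dimensions are locally constant and invariant under the torus, so they survive the limit;
    the punctured neighbourhood supplies a nonzero [z] close enough to 0. *)
Lemma leaf_flag_dim i x k : leaf sigma i x -> flag_dim x k = flag_dim (fixed i) k.
Proof.
move=> [_ limx].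
have nD : nbhs (fixed i) [set p | flag_dim p k = flag_dim (fixed i) k].
  by apply: open_nbhs_nbhs; split; [exact: open_flag_dim|].
have := limx _ nD => lz.
have [z [/= <- z0]] : exists z : C, flag_dim (flag_act (cocharacter sigma z) x) k =
    flag_dim (fixed i) k /\ z != 0.
  apply: (@filter_ex _ ((0 : C)^')).
  by apply: filterI; [exact: lz|exact: withinT].
by rewrite flag_dim_act //; exact: cocharacter_torus.
Qed.

Lemma leaf_order_flag_dim (i j : 'I_N * 'I_N) k : leaf_order R sigma i j ->
  flag_dim (fixed i) k = flag_dim (fixed j) k.
Proof.
move=> /connectP[p + ->] {j}; elim: p i => //= j p IH i /andP[/asboolP ij jp].
rewrite -(IH j jp).
have nD : nbhs (fixed j) [set p | flag_dim p k = flag_dim (fixed j) k].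
  by apply: open_nbhs_nbhs; split; [exact: open_flag_dim|].
by have [x [/leaf_flag_dim xi /= <-]] := ij _ nD.
Qed.

(** Comparable fixed points have the same dimension vector. Which of [i] and [swap i] is the larger
    one is left undecided. *)
Lemma leaf_order_swap (i j : 'I_N * 'I_N) : leaf_order R sigma i j -> j = i \/ j = swap i.
Proof. by move=> ij; apply: (@same_dim_swap R) => k; exact: leaf_order_flag_dim. Qed.

(** Whichever leaf contains [fixed j] has it in its closure, which is one more generating
    relation. *)
Lemma fixed_in_slope i j : slope sigma i (fixed j) -> leaf_order R sigma i j.
Proof.
move=> [k /= ik jk]; apply: (connect_trans ik); apply/connect1/asboolP.
exact: subset_closure.
Qed.

End LeafOrder.

(** * A path of flags between two fixed points *)

Section LinePath.
Variables (R : realType) (N : nat).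
Local Notation C := (cplx R).
Local Notation fixed := (@fixed_point R N).

Lemma real_complex_continuous : continuous (fun t : R => real_complex R t : C).
Proof.
move=> t; apply/cvgrPdist_lt => e e0.
(* A positive element of [C] is real, so the estimate can be made in [R]. *)
have eE : e = real_complex R (complex.Re e) by rewrite RRe_real // gtr0_real.
have Re0 : 0 < complex.Re e by rewrite -ltcR -eE.
near=> s.
have -> : (real_complex R t : C) - real_complex R s = real_complex R (t - s).
  by rewrite [RHS]rmorphB.
rewrite (_ : `|_| = real_complex R `|t - s|); last first.
  by rewrite normc_def /= expr0n addr0 sqrtr_sqr.
rewrite eE ltcR; near: s.
by have /cvgrPdist_lt := @cvg_id _ (nbhs t); apply.
Unshelve. all: by end_near.
Qed.

Lemma column_space_continuous (T : topologicalType) k (M : T -> 'M[C]_(2, k)) :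
  continuous M -> (forall t, \rank (M t) = k) ->
  continuous (fun t => column_space (M t)).
Proof.
move=> /continuousP cM rM; apply/continuousP => U oU.
have [O oO OU] := oU k.
rewrite (_ : _ @^-1` U = M @^-1` O); first exact: cM.
by apply/seteqP; split=> t /(OU _ (rM t)).
Qed.

(** The affine line through the two basis vectors. The coordinates 1 - t and t never vanish
    together, so a line is spanned for every real t, as a homotopy over all of [R] requires. *)
Definition line_vector (t : R) : 'cV[C]_2 :=
  basis_vector R 0 + (real_complex R t : C) *: (basis_vector R 1 - basis_vector R 0).

Lemma line_vector_continuous : continuous line_vector.
Proof.
move=> t; apply: (@continuousD _ ('cV[C]_2 : normedModType C) R (cst (basis_vector R 0))
    (fun t => (real_complex R t : C) *: (basis_vector R 1 - basis_vector R 0))).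
  exact: cst_continuous.
apply: (@continuous_comp _ _ _ (fun t : R => real_complex R t : C)
  (fun a : C => a *: (basis_vector R 1 - basis_vector R 0))).
  exact: real_complex_continuous.
exact: scalel_continuous.
Qed.

Lemma line_vector_rank t : \rank (line_vector t) = 1.
Proof.
apply/eqP; rewrite eqn_leq rank_leq_col lt0n mxrank_eq0; apply/eqP => v0.
have /matrixP/(_ 0 0) := v0; have /matrixP/(_ 1 0) := v0.
rewrite !mxE /= subr0 mulr1 add0r => ->; rewrite mul0r addr0 => /eqP.
by rewrite oner_eq0.
Qed.

Lemma column_spaceE (v : 'cV[C]_2) : column_space v = <[v]>%VS.
Proof.
apply/vspaceP => w; apply/memv_imgP/vlineP => [[u _ ->]|[k ->]].
  by exists (u 0 0); rewrite lfunE /= {1}[u]mx11_scalar mul_mx_scalar.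
by exists k%:M; rewrite ?memvf // lfunE /= mul_mx_scalar.
Qed.

Lemma line_continuous : continuous (fun t => <[line_vector t]>%VS : grassmannian R).
Proof.
have -> : (fun t => <[line_vector t]>%VS : grassmannian R) =
    (fun t => column_space (line_vector t)).
  by apply/funext => t; rewrite column_spaceE.
apply: column_space_continuous; first exact: line_vector_continuous.
exact: line_vector_rank.
Qed.

(* The flags through the line of line_vector t, with labels m <= n: from the fixed
   point (n, m) at t = 0 to the fixed point (m, n) at t = 1. *)
Definition flag_path (m n : nat) (t : R) : flag_tspace R N :=
  ((fun k : 'I_N.-1 => if (k < m)%N then fullv
     else if (k < n)%N then <[line_vector t]>%VS else 0%VS), 0).

Lemma flag_path_continuous m n : continuous (flag_path m n).
Proof.
apply: pair_continuous; last exact: cst_continuous.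
apply: (@ptws_continuous _ _ (fun=> grassmannian R : topologicalType)) => k /=.
case: (k < m)%N; first exact: cst_continuous.
case: (k < n)%N; last exact: cst_continuous.
exact: line_continuous.
Qed.

(* The elements t o collapse form the subtorus u_1 = u_2. *)
Definition collapse (i : 'I_3) : 'I_3 := if i == u_index 1 then u_index 0 else i.

(** On the subtorus u_1 = u_2 the standard representation is scalar and preserves every subspace. *)
Lemma flag_path_fixed m n t : point_fixed collapse (flag_path m n t).
Proof.
move=> z Tz; rewrite /= /flag_act /= mulmx0 mul0mx scaler0; congr pair.
apply/funext => k; apply: (@limg_scale _ (z (u_index 0))); first exact: Tz.
apply/matrixP => a b; rewrite !mxE; case: eqP => // _; rewrite /collapse.
case: eqP => // /eqP; rewrite -val_eqE /= => b1; congr (z _ *+ _).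
by apply/val_inj => /=; case: a b1 => [[|[|[]]]].

Qed.

Lemma flag_path_in m n t : (m <= n)%N -> cotangent_flags (flag_path m n t).
Proof.
move=> mn; split=> [k l kl|x _] /=; last by rewrite mul0mx mxtrace0.
have [lm|ml] := ltnP l m; first by rewrite (leq_ltn_trans kl lm).
have [ln|nl] := ltnP l n; last by rewrite sub0v.
by rewrite (leq_ltn_trans kl ln); case: ifP => _; rewrite ?subvf ?subvv.
Qed.

Lemma coordinate_space_full (P : pred 'I_2) : (forall s, P s) ->
  (\sum_(s < 2 | P s) <[basis_vector R s]>)%VS = fullv.
Proof.
move=> Ps; apply/vspaceP => v; rewrite mem_coordinate_space memvf.
by apply/forallP => s; rewrite Ps.
Qed.

Lemma flag_path0 (i : 'I_N * 'I_N) : (i.2 <= i.1)%N -> flag_path i.2 i.1 0 = fixed i.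
Proof.
move=> i21; congr pair; apply/funext => k /=.
rewrite big_mkcond big_ord_recl big_ord1 /= /label /= /line_vector scale0r addr0.
have [k2|k2] := ltnP k i.2; last by rewrite addv0.
rewrite (leq_trans k2 i21) -(@coordinate_space_full xpredT) //.
by rewrite big_ord_recl big_ord1.
Qed.

Lemma flag_path1 (i : 'I_N * 'I_N) : (i.1 <= i.2)%N -> flag_path i.1 i.2 1 = fixed i.
Proof.
move=> i12; congr pair; apply/funext => k /=.
rewrite big_mkcond big_ord_recl big_ord1 /= /label /= /line_vector.
rewrite (_ : (real_complex R 1 : C) = 1) // scale1r addrC subrK.
have [k1|k1] := ltnP k i.1; last by rewrite add0v (_ : lift ord0 ord0 = 1) //; exact/val_inj.
rewrite (leq_trans k1 i12) -(@coordinate_space_full xpredT) //.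
by rewrite big_ord_recl big_ord1.
Qed.

End LinePath.

(** * Restriction to the fixed points *)

Section PointPullbackMorphism.
Variables (R : realType) (r : nat) (Y : tspace R r) (A : set Y) (pi : 'I_r -> 'I_r).
Variables (y : Y) (yfix : point_fixed pi y) (Ay : A y).

HB.instance Definition _ :=
  GRing.RMorphism.copy (point_pullback yfix Ay : eqcohom A -> eqcohom_pt R r)
    (pullback (R := R)
      (quotient_map_continuous (@point_map_continuous R r Y pi y)
        (point_map_equivariant yfix))
      (point_map_borel yfix Ay)).

End PointPullbackMorphism.

HB.instance Definition _ (R : realType) (r : nat) (pi : 'I_r -> 'I_r) :=
  GRing.RMorphism.copy (bt_pullback pi : eqcohom_pt R r -> eqcohom_pt R r)
   (point_pullback (point_tspace_fixed pi) (I : [set: point_tspace R r] tt)).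

Lemma bt_pullbackZ (R : realType) (r : nat) (pi : 'I_r -> 'I_r) (a : cplx R) x :
  bt_pullback pi (a *: x) = a *: bt_pullback pi x :> eqcohom_pt R r.
Proof. exact: pullback_scalable. Qed.

Section Specialization.
Variable R : realType.
Local Notation C := (cplx R).
Local Notation K := (mpoly 3 C).
Local Notation eqvar := (eqvar R).

(** The substitution u_2 = u_1, that is, reduction modulo u. *)
Definition collapse_poly (q : K) : K :=
  comp_mpoly [tuple eqvar (collapse i) | i < 3] q.

Lemma mpoly_monomE (q : K) :
  q = \sum_(m <- msupp q) (mcoeff m q *: \prod_(i < 3) eqvar i ^+ (m i)).
Proof. by rewrite {1}[q]mpolyE; apply: eq_bigr => m _; rewrite mpolyXE_id. Qed.

Lemma collapse_polyE (q : K) : collapse_poly q =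
  \sum_(m <- msupp q) (mcoeff m q *: \prod_(i < 3) eqvar (collapse i) ^+ (m i)).
Proof.
rewrite /collapse_poly comp_mpolyEX; apply: eq_bigr => m _; congr (_ *: _).
by rewrite comp_mpolyX; apply: eq_bigr => i _; rewrite tnth_mktuple.
Qed.

(** Such a polynomial involves hbar alone, and the substitution only affects u_2. *)
Lemma collapse_poly_degree0 (q : K) : A_degree_lt 1 q -> collapse_poly q = q.
Proof.
move=> dq; rewrite collapse_polyE [RHS]mpoly_monomE; apply: eq_big_seq => m /dq.
rewrite ltnS leqn0 addn_eq0 => /andP[_ /eqP m1]; congr (_ *: _).
apply: eq_bigr => i _; rewrite /collapse; case: eqP => // ->.
by rewrite (_ : u_index 1 = u_index ord_max) ?m1 ?expr0 //; apply/val_inj.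
Qed.

Variables (c : eqcohom_pt R 1) (phi : {rmorphism K -> eqcohom_pt R 3}).
Hypothesis hphi : is_char_iso c phi.

Lemma phi_inj : injective phi.
Proof. by case: hphi => _ _ /bij_inj. Qed.

(** Expansion into monomials reduces the claim to the generators, which are character classes and
    get reindexed by [collapse]. *)
Lemma bt_pullback_collapse (q : K) : bt_pullback collapse (phi q) = phi (collapse_poly q).
Proof.
case: hphi => _ phiZ _ phiX.
rewrite collapse_polyE {1}[q]mpoly_monomE !rmorph_sum; apply: eq_bigr => m _.
rewrite !phiZ [LHS]bt_pullbackZ; congr (_ *: _).
rewrite !rmorph_prod; apply: eq_bigr => i _; rewrite !rmorphXn; congr (_ ^+ _).
by rewrite !phiX; exact: bt_pullback_char_class.
Qed.

Variable N : nat.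
Local Notation X := (@cotangent_flags R N).
Local Notation fixed := (@fixed_point R N).

(** Transport for the endpoints of [flag_path], which equal fixed points only by a proved
    equation. *)
Lemma eq_point_pullback pi (y y' : flag_tspace R N) (yfix : point_fixed pi y)
    (yfix' : point_fixed pi y') (Xy : X y) (Xy' : X y') x :
  y = y' -> point_pullback yfix Xy x = point_pullback yfix' Xy' x.
Proof.
move=> yy'; case: y' / yy' yfix' Xy' => yfix' Xy'.
by rewrite (Prop_irrelevance yfix yfix') (Prop_irrelevance Xy Xy').
Qed.

Definition fixed_pullback (i : 'I_N * 'I_N) : eqcohom X -> eqcohom_pt R 3 :=
  point_pullback (@fixed_point_fixed R N i) (@fixed_point_in R N i).

HB.instance Definition _ i :=
  GRing.RMorphism.copy (fixed_pullback i)
    (point_pullback (@fixed_point_fixed R N i) (@fixed_point_in R N i)).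

Lemma fixed_pullback_eqscalar i q : fixed_pullback i (eqscalar phi X q) = phi q.
Proof. by rewrite /fixed_pullback point_pullback_structure bt_pullback_id. Qed.

Lemma fixed_pullback_restrict i x q :
  Defs.restrict (@fixed_sub R N i) x = eqscalar phi [set fixed i] q ->
  fixed_pullback i x = phi q.
Proof.
move=> xq; rewrite /fixed_pullback.
rewrite -(point_pullback_restrict (@fixed_sub R N i) _ (erefl : [set fixed i] (fixed i))).
by rewrite xq point_pullback_structure bt_pullback_id.
Qed.

(** By [fixed_in_slope] the point [fixed j] lies off the slope, so restriction to it factors through
    the complement. *)
Lemma fixed_pullback_off_slope sigma i j x : ~ leaf_order R sigma i j ->
  Defs.restrict (@off_slope R N sigma i) x = 0 -> fixed_pullback j x = 0.
Proof.
move=> nij x0; have Xj : (X `\` slope sigma i) (fixed j).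
  by split; [exact: fixed_point_in|move=> /fixed_in_slope].
by rewrite /fixed_pullback -(point_pullback_restrict (@off_slope R N sigma i) _ Xj) x0 raddf0.
Qed.

(* The localization relation of GKM on the line that joins i and swap i. *)
Lemma bt_pullback_fixed_pullback i x : bt_pullback collapse (fixed_pullback i x) =
  bt_pullback collapse (fixed_pullback (swap i) x).
Proof.
(* The path starts at [i] only when the first label is the larger one; the claim is symmetric under
   [swap]. *)
wlog i21 : i / (i.2 <= i.1)%N.
  move=> H; have [/H//|/ltnW i12] := leqP i.2 i.1.
  by rewrite [RHS](H (swap i)) // /swap -surjective_pairing.
have fixC j (t : R) (jt : flag_path N i.2 i.1 t = fixed j) : point_fixed collapse (fixed j).
  by rewrite -jt; exact: flag_path_fixed.
have p0 := flag_path0 R i21; have p1 := @flag_path1 R N (swap i) i21.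
have XP t : X (flag_path N i.2 i.1 t) by exact: flag_path_in.
have PP := point_pullback_path (@flag_path_continuous R N i.2 i.1)
  (fun t => @flag_path_fixed R N i.2 i.1 t) XP x.
have e0 := eq_point_pullback (@flag_path_fixed R N i.2 i.1 0) (fixC _ _ p0)
  (XP 0) (@fixed_point_in R N i) x p0.
have e1 := eq_point_pullback (@flag_path_fixed R N i.2 i.1 1) (fixC _ _ p1)
  (XP 1) (@fixed_point_in R N (swap i)) x p1.
have := etrans (esym e0) (etrans PP e1) => e.
rewrite [LHS](bt_pullback_point_pullback _ (fixC _ _ p0)).
by rewrite [RHS](bt_pullback_point_pullback _ (fixC _ _ p1)).
Qed.

End Specialization.

(** * Stable classes at the fixed points *)

Section Weights.
Variables (R : realType) (N : nat).
Local Notation C := (cplx R).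
Local Notation K := (mpoly 3 C).
Local Notation eqvar := (eqvar R).

(** The tangent weight at [i] of the projective line through [i] and [swap i]; for equal labels the
    value is a default. *)
Definition root_char (i : 'I_N * 'I_N) : 'rV[int]_3 :=
  if (i.1 < i.2)%N then u_char 0 - u_char 1 else u_char 1 - u_char 0.

Definition root_poly (i : 'I_N * 'I_N) : K :=
  if (i.1 < i.2)%N then u_var R else - u_var R.

Lemma flag_weights_diag (i : 'I_N * 'I_N) : i.1 = i.2 -> flag_weights R i = [::].
Proof.
move=> i12; rewrite /flag_weights (@eq_filter _ _ pred0) ?filter_pred0 // => ab /=.
by rewrite stabilizes_delta_mx /label i12 !if_same leqnn.
Qed.

Lemma flag_weights_off (i : 'I_N * 'I_N) : i.1 != i.2 -> flag_weights R i = [:: root_char i].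
Proof.
move=> i12; pose a : 'I_2 := if (i.1 < i.2)%N then 0 else 1.
pose b : 'I_2 := if (i.1 < i.2)%N then 1 else 0.
rewrite /flag_weights (@eq_filter _ _ (pred1 (a, b))) => [|[x y] /=]; last first.
  rewrite stabilizes_delta_mx -ltnNge xpair_eqE /label /a /b.
  have I2 (z : 'I_2) : z = 0 \/ z = 1.
    by case: z => [[|[|//]]] ?; [left|right]; exact/val_inj.
  case: (I2 x) => ->; case: (I2 y) => ->; rewrite /= ?ltnn;
    case: ltngtP i12 => // /val_inj ->; rewrite ?eqxx //.
rewrite [seq.filter _ _](@filter_pred1_uniq _ _ (a, b)) ?enum_uniq ?mem_enum //=.
by rewrite /a /b /root_char; case: ifP.
Qed.

Lemma linear_formB v w : linear_form R (v - w) = linear_form R v - linear_form R w.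
Proof.
rewrite /linear_form -sumrB; apply: eq_bigr => i _.
by rewrite !mxE mulrzBr.
Qed.

Lemma linear_form_delta k : linear_form R (delta_mx 0 k) = eqvar k.
Proof.
rewrite /linear_form (bigD1 k) //= big1 ?addr0 => [|i ik].
  by rewrite mxE !eqxx mulr1z.
by rewrite mxE eqxx (negPf ik) mulr0z.
Qed.

Lemma linear_form_root (i : 'I_N * 'I_N) : linear_form R (root_char i) = root_poly i.
Proof.
rewrite /root_char /root_poly /u_var; case: ifP => _.
all: rewrite linear_formB !linear_form_delta ?opprB //.
Qed.

Definition positive_root (sigma : int * int) (i : 'I_N * 'I_N) : bool :=
  (0 < pairing sigma (root_char i)).

Lemma pairingB sigma v w : pairing sigma (v - w) = pairing sigma v - pairing sigma w.
Proof. by rewrite /pairing !mxE; ring. Qed.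

Lemma pairing_h sigma w : pairing sigma (h_char - w) = - pairing sigma w.
Proof. by rewrite pairingB {1}/pairing !mxE /= !mul0r addr0 sub0r. Qed.

Lemma euler_minus_diag sigma (i : 'I_N * 'I_N) : i.1 = i.2 -> euler_minus R sigma i = 1.
Proof.
move=> i12; rewrite /euler_minus /normal_weights flag_weights_diag //=.
by rewrite /euler big_nil.
Qed.

(** Cocharacters have no hbar component, so the two normal weights w and hbar - w pair to opposite
    values and exactly one of them is negative. *)
Lemma euler_minus_off sigma (i : 'I_N * 'I_N) :
  i.1 != i.2 -> pairing sigma (root_char i) != 0 ->
  euler_minus R sigma i =
  if positive_root sigma i then h_var R - root_poly i else root_poly i.
Proof.
move=> i12 p0; rewrite /euler_minus /normal_weights flag_weights_off //= pairing_h.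
rewrite oppr_lt0 /positive_root; case: ltgtP p0 => //= _ _.
  by rewrite /euler big_seq1 linear_form_root.
by rewrite /euler big_seq1 linear_formB linear_form_root linear_form_delta.
Qed.

(** Evaluation at u_1 = 1, u_2 = hbar = 0 serves below to show that polynomials are nonzero. *)
Lemma eval_u : meval (fun i : 'I_3 => (i == u_index 0)%:R) (u_var R) = 1.
Proof. by rewrite /u_var mevalB !mevalXU /= subr0. Qed.

Lemma uh_var_neq0 : u_var R + h_var R != 0.
Proof.
apply/eqP => u0; have := congr1 (meval (fun i : 'I_3 => (i == u_index 0)%:R)) u0.
by rewrite mevalD eval_u mevalXU meval0 /= addr0 => /eqP; rewrite oner_eq0.
Qed.

(** A nonzero polynomial is not its own negative in characteristic 0. This pins down the sign in the
    normalization axiom. *)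
Lemma root_poly_sign (s : bool) (i : 'I_N * 'I_N) :
  (-1) ^+ s * root_poly i = root_poly i -> s = false.
Proof.
case: s => //=; rewrite expr1 mulN1r => /eqP; rewrite eq_sym -addr_eq0 => /eqP e.
have : u_var R + u_var R = 0.
  by move: e; rewrite /root_poly; case: ifP => // _ /eqP; rewrite -opprD oppr_eq0 => /eqP.
move=> /(congr1 (meval (fun i : 'I_3 => (i == u_index 0)%:R))).
by rewrite mevalD eval_u meval0 => /eqP; rewrite -mulr2n pnatr_eq0.
Qed.

HB.instance Definition _ :=
  GRing.RMorphism.copy (@restrict_to_A R)
    (comp_mpoly [tuple eqvar (u_index 0); eqvar (u_index 1); 0]).
HB.instance Definition _ :=
  GRing.RMorphism.copy (@collapse_poly R)
    (comp_mpoly [tuple eqvar (collapse i) | i < 3]).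

Lemma restrict_to_A_var k :
  restrict_to_A (eqvar k) = [:: eqvar (u_index 0); eqvar (u_index 1); 0]`_k.
Proof. exact: comp_mpolyXU. Qed.

Lemma restrict_to_A_root (i : 'I_N * 'I_N) : restrict_to_A (root_poly i) = root_poly i.
Proof.
have uE : restrict_to_A (u_var R) = u_var R.
  by rewrite /u_var rmorphB /= !restrict_to_A_var.
by rewrite /root_poly; case: ifP; rewrite ?rmorphN /= uE.
Qed.

Lemma restrict_to_A_h : restrict_to_A (h_var R) = 0.
Proof. exact: restrict_to_A_var. Qed.

Lemma collapse_poly_var i : collapse_poly (eqvar i) = eqvar (collapse i).
Proof.
transitivity [tuple eqvar (collapse j) | j < 3]`_i; first exact: comp_mpolyXU.
by rewrite -tnth_nth tnth_mktuple.
Qed.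

Lemma collapse_poly_root (i : 'I_N * 'I_N) : collapse_poly (root_poly i) = 0.
Proof.
have uE : collapse_poly (u_var R) = 0.
  by rewrite /u_var rmorphB /= !collapse_poly_var /collapse /= subrr.
by rewrite /root_poly; case: ifP; rewrite ?rmorphN /= uE ?oppr0.
Qed.

Lemma collapse_poly_h : collapse_poly (h_var R) = h_var R.
Proof. by rewrite collapse_poly_var. Qed.

End Weights.

(** * The restriction matrix of a stable map *)

Section StableValues.
Variables (R : realType) (N : nat).
Local Notation C := (cplx R).
Local Notation K := (mpoly 3 C).
Local Notation X := (@cotangent_flags R N).
Variables (c : eqcohom_pt R 1) (phi : {rmorphism K -> eqcohom_pt R 3}).
Hypothesis hphi : is_char_iso c phi.
Variables (sigma : int * int) (S : 'M[K]_N -> eqcohom X).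
Hypothesis stabS : stable_map phi sigma S.
Hypothesis sigma0 : pairing sigma (u_char 0 - u_char 1) != 0.

Lemma pairing_root_neq0 (i : 'I_N * 'I_N) : pairing sigma (root_char i) != 0.
Proof.
rewrite /root_char; case: ifP => // _.
by move: sigma0; rewrite !pairingB !subr_eq0 eq_sym.
Qed.

(** There are no normal weights, so both Euler class and polarization are empty products and the
    sign is +1. *)
Lemma stable_diag (i : 'I_N * 'I_N) : i.1 = i.2 ->
  fixed_pullback i (S (fixed_class R i)) = phi 1.
Proof.
move=> i12; have [s pol /(_ 1)] := stable_normal stabS i.
rewrite scale1r => /fixed_pullback_restrict ->; congr (phi _).
move: pol; rewrite /polarization euler_minus_diag // flag_weights_diag //.
by rewrite /euler big_nil !mulr1 rmorph1 rmorphXn rmorphN1.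
Qed.

(** At hbar = 0 the class [euler_minus] becomes minus the root if the root is positive, and the root
    otherwise, while the polarization is always the root. So the sign is -1 exactly for a positive
    root. *)
Lemma stable_off (i : 'I_N * 'I_N) : i.1 != i.2 ->
  fixed_pullback i (S (fixed_class R i)) =
  phi (root_poly R i - h_var R *+ positive_root sigma i).
Proof.
move=> i12; have [s pol /(_ 1)] := stable_normal stabS i.
rewrite scale1r => /fixed_pullback_restrict ->; congr (phi _).
move: pol; rewrite /polarization flag_weights_off // {1}/euler big_seq1.
rewrite linear_form_root restrict_to_A_root euler_minus_off ?pairing_root_neq0 //.
rewrite mulr1 rmorphM rmorphXn rmorphN1 /=.
case: ifP => _; last first.
  by rewrite restrict_to_A_root => /root_poly_sign ->; rewrite expr0 mul1r subr0.
rewrite rmorphB /= restrict_to_A_h restrict_to_A_root sub0r.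
case: s => [_|]; first by rewrite expr1 mulN1r opprB mulr1n.
by rewrite expr0 mul1r -mulN1r => /(@root_poly_sign _ _ true).
Qed.

Lemma stable_off_order (i j : 'I_N * 'I_N) : ~ leaf_order R sigma i j ->
  fixed_pullback j (S (fixed_class R i)) = 0.
Proof.
move=> nij; apply: (fixed_pullback_off_slope nij).
by have := stable_support stabS i 1; rewrite scale1r.
Qed.

Lemma swapK (i : 'I_N * 'I_N) : swap (swap i) = i.
Proof. by case: i. Qed.

Lemma swap_eq (i : 'I_N * 'I_N) : (swap i == i) = (i.1 == i.2).
Proof. by case: i => a b; rewrite xpair_eqE /= eq_sym andbb. Qed.

(** The restriction is a polynomial [q] fixed by [collapse_poly]: by the degree axiom, as half the
    codimension is 1, or because it vanishes by the support axiom. Hence [q] equals the reduction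
    modulo u of the restriction to [i], where the root dies. *)
Lemma stable_swap (i : 'I_N * 'I_N) : i.1 != i.2 ->
  fixed_pullback (swap i) (S (fixed_class R i)) =
  phi (- h_var R *+ positive_root sigma i).
Proof.
move=> i12.
suff [q qE cq] : exists2 q, fixed_pullback (swap i) (S (fixed_class R i)) = phi q &
    collapse_poly q = q.
  have := bt_pullback_fixed_pullback i (S (fixed_class R i)).
  rewrite qE stable_off // !(bt_pullback_collapse hphi) => /(phi_inj hphi).
  rewrite cq rmorphB rmorphMn /= collapse_poly_root collapse_poly_h sub0r mulNrn.
  by move=> ->.
have [ij|nij] := boolP (leaf_order R sigma i (swap i)); last first.
  by exists 0; [rewrite stable_off_order ?rmorph0//; exact/negP|rewrite rmorph0].
have [||q] := @stable_degree _ _ _ _ _ stabS i 1 _ _ ij.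
- move=> m; rewrite msupp1 inE => /eqP ->; by rewrite !mnm0E.
- by rewrite swap_eq.
rewrite scale1r => /fixed_pullback_restrict qE dq; exists q => //.
apply: collapse_poly_degree0; move: dq.
by rewrite /normal_weights flag_weights_off //= eq_sym.
Qed.

(** For equal labels [swap i] is [i], so the test [k == i] has to come first. *)
Definition stable_coef (i k : 'I_N * 'I_N) : K :=
  if k == i then
    if i.1 == i.2 then 1 else root_poly R i - h_var R *+ positive_root sigma i
  else if k == swap i then - h_var R *+ positive_root sigma i else 0.

Lemma stable_coefE (i k : 'I_N * 'I_N) :
  fixed_pullback k (S (fixed_class R i)) = phi (stable_coef i k).
Proof.
rewrite /stable_coef; case: eqVneq => [->|ki].
  by case: eqP => [/stable_diag//|/eqP/stable_off].
have [ks|ks] := eqVneq k (swap i).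
  by rewrite ks stable_swap // -swap_eq -ks.
rewrite rmorph0; apply: stable_off_order => /leaf_order_swap[] /eqP; exact/negP.
Qed.

End StableValues.

(** * Localized classes *)

Lemma fraction_clear (D : idomainType) (x : {fraction D}) :
  exists2 d : D, d != 0 & exists n, FracField.tofrac d * x = FracField.tofrac n.
Proof.
elim/quotW: x => r; exists (val r).2; first exact: denom_ratioP.
exists (val r).1; rewrite /GRing.mul /= !piE; apply/eqmodP.
rewrite /= FracField.equivfE /FracField.mulf.
rewrite !numden_Ratio ?mulf_neq0 ?oner_eq0 ?denom_ratioP //.
by rewrite mulr1 mul1r mulrC.
Qed.

Lemma fraction_clear_family (D : idomainType) (I : finType) (v : I -> {fraction D}) :
  exists2 d : D, d != 0 &
    exists q : I -> D, forall i, FracField.tofrac d * v i = FracField.tofrac (q i).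
Proof.
have /choice[d dP] : forall i, exists d : D,
    d != 0 /\ exists n, FracField.tofrac d * v i = FracField.tofrac n.
  by move=> i; have [d d0 dv] := fraction_clear (v i); exists d.
have /choice[n nP] i := (dP i).2.
(* The common denominator is the product of the individual ones; numerator [i] picks up all the
   other factors. *)
exists (\prod_i d i); first by apply/prodf_neq0 => i _; case: (dP i).
exists (fun i => (\prod_(j | j != i) d j) * n i) => i.
by rewrite (bigD1 i) //= [d i * _]mulrC !tofracM -mulrA nP.
Qed.

Section Localization.
Variables (R : realType) (N : nat).
Local Notation C := (cplx R).
Local Notation K := (mpoly 3 C).
Local Notation X := (@cotangent_flags R N).

Lemma root_coef_neq0 (b : bool) (i : 'I_N * 'I_N) : root_poly R i - h_var R *+ b != 0.
Proof.
apply/eqP => u0; have := congr1 (meval (fun i : 'I_3 => (i == u_index 0)%:R)) u0.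
rewrite mevalB mevalMn mevalXU mul0rn subr0 meval0 /root_poly => /eqP.
by case: ifP => _; rewrite ?mevalN eval_u ?oppr_eq0 oner_eq0.
Qed.

Lemma positive_root_swap sigma (i : 'I_N * 'I_N) :
  pairing sigma (u_char 0 - u_char 1) != 0 -> i.1 != i.2 ->
  positive_root sigma (swap i) = ~~ positive_root sigma i.
Proof.
move=> s0 i12; rewrite /positive_root /root_char /= -leNgt le_eqVlt.
rewrite (_ : (i.2 < i.1)%N = ~~ (i.1 < i.2)%N); last first.
  by case: ltngtP i12 => // /val_inj ->; rewrite eqxx.
have e : pairing sigma (u_char 1 - u_char 0) = - pairing sigma (u_char 0 - u_char 1).
  by rewrite !pairingB opprB.
by case: (i.1 < i.2)%N; rewrite /= e ?oppr_gt0 ?oppr_lt0 ?oppr_eq0 (negPf s0).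
Qed.

(** Only the classes labelled [k] and [swap k] can be nonzero at [k]; the boolean factor avoids
    counting one twice when they coincide. *)
Lemma sum_stable_coef sigma (q : 'I_N * 'I_N -> K) (k : 'I_N * 'I_N) :
  \sum_p q p * stable_coef R sigma p k =
  q k * stable_coef R sigma k k +
  (k != swap k)%:R * (q (swap k) * stable_coef R sigma (swap k) k).
Proof.
rewrite (bigD1 k) //=; congr +%R; have [kk|kk] := eqVneq k (swap k).
  rewrite mul0r big1 // => p pk; rewrite /stable_coef eq_sym (negPf pk) kk.
  by rewrite (inj_eq (can_inj (@swapK N))) eq_sym (negPf pk) mulr0.
rewrite mul1r (bigD1 (swap k)) ?[_ == k]eq_sym //= big1 ?addr0 // => p /andP[pk ps].
rewrite /stable_coef eq_sym (negPf pk) -[k]swapK (inj_eq (can_inj (@swapK N))).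
by rewrite eq_sym (negPf ps) mulr0.
Qed.

(* The restriction matrix is triangular with respect to positive_root. *)
Lemma stable_coef_free sigma (q : 'I_N * 'I_N -> K) :
  pairing sigma (u_char 0 - u_char 1) != 0 ->
  (forall k, \sum_p q p * stable_coef R sigma p k = 0) -> forall k, q k = 0.
Proof.
move=> s0 q0.
have E k : q k * stable_coef R sigma k k +
    (k != swap k)%:R * (q (swap k) * stable_coef R sigma (swap k) k) = 0.
  by rewrite -sum_stable_coef.
(* If the root at [k] is positive, the one at [swap k] is not, so the class of [swap k] vanishes at
   [k] and a single term remains. The other case then uses that [q (swap k)] is already 0. *)
have pos k : k.1 != k.2 -> positive_root sigma k -> q k = 0.
  move=> k12 pk; have := E k; rewrite /stable_coef eqxx (negPf k12).
  rewrite swapK eqxx [k == _]eq_sym swap_eq (negPf k12) mul1r.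
  rewrite positive_root_swap // pk mulr0n mulr0 addr0 => /eqP.
  by rewrite mulf_eq0 (negPf (root_coef_neq0 _ _)) orbF => /eqP.
move=> k; have [k12|k12] := eqVneq k.1 k.2.
  have := E k; rewrite /stable_coef eqxx k12 eqxx mulr1.
  by rewrite [k == _]eq_sym swap_eq k12 eqxx mul0r addr0.
have [pk|pk] := boolP (positive_root sigma k); first exact: pos.
have sk : q (swap k) = 0.
  by apply: pos; [rewrite /= eq_sym|rewrite positive_root_swap].
have := E k; rewrite sk mul0r mulr0 addr0 /stable_coef eqxx (negPf k12) => /eqP.
by rewrite mulf_eq0 (negPf (root_coef_neq0 _ _)) orbF => /eqP.
Qed.

(** Opposite chambers have opposite positive roots. For [i.1 < i.2] the entries at [i] and [swap i]
    read (u + h)(u - h) = u^2 - h^2 and -(u + h)h = h(-u - h). *)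
Lemma stable_coef_exchange sigma1 sigma2 (i k : 'I_N * 'I_N) :
  0 < pairing sigma1 (u_char 0 - u_char 1) ->
  pairing sigma2 (u_char 0 - u_char 1) < 0 ->
  (u_var R + h_var R) * stable_coef R sigma1 i k =
  u_var R * stable_coef R sigma2 i k + h_var R * stable_coef R sigma2 (swap i) k.
Proof.
move=> s1 s2; have [i12|i12] := eqVneq i.1 i.2.
  have -> : swap i = i by apply/eqP; rewrite swap_eq i12.
  rewrite -mulrDl; congr (_ * _); rewrite /stable_coef i12 eqxx.
  have -> : swap i = i by apply/eqP; rewrite swap_eq i12.
  by case: (k == i).
have p1 : positive_root sigma1 i = (i.1 < i.2)%N.
  rewrite /positive_root /root_char; case: ifP => // _; move: s1; rewrite !pairingB.
  by rewrite subr_gt0 => /ltW; rewrite subr_gt0 ltNge => ->.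
have p2 : positive_root sigma2 i = ~~ (i.1 < i.2)%N.
  rewrite /positive_root /root_char; case: ifP => // _; move: s2; rewrite !pairingB.
    by rewrite subr_lt0 => /ltW; rewrite subr_gt0 ltNge => ->.
  by rewrite subr_lt0 subr_gt0.
have r_swap : root_poly R (swap i) = - root_poly R i.
  rewrite /root_poly /=; case: (ltngtP i.1 i.2) => // [_|e]; first by rewrite opprK.
  by move/val_inj/eqP: e; rewrite (negPf i12).
have p2' : positive_root sigma2 (swap i) = (i.1 < i.2)%N.
  have s2N0 : pairing sigma2 (u_char 0 - u_char 1) != 0 by rewrite lt_eqF.
  by rewrite positive_root_swap // p2 negbK.
rewrite /stable_coef swapK (negPf i12) [(swap i).1 == _]eq_sym (negPf i12) p1 p2 p2' r_swap.
have [->|ki] := eqVneq k i.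
  rewrite [i == _]eq_sym swap_eq (negPf i12) /root_poly.
  by case: ifP => _; rewrite /= ?mulr0n ?mulr1n; ring.
have [_|ks] := eqVneq k (swap i); last by rewrite !mulr0 addr0.
rewrite /root_poly.
by case: ifP => _; rewrite /= ?mulr0n ?mulr1n; ring.
Qed.

Variables (c : eqcohom_pt R 1) (phi : {rmorphism K -> eqcohom_pt R 3}).
Hypothesis hphi : is_char_iso c phi.
Variables (sigma : int * int) (S : 'M[K]_N -> eqcohom X).
Hypothesis stabS : stable_map phi sigma S.
Hypothesis sigma0 : pairing sigma (u_char 0 - u_char 1) != 0.
Local Notation F := {fraction K}.
Variables (L : lmodType F) (loc : {additive eqcohom X -> L}).
Hypothesis hloc : is_localization phi loc.

(* By hypothesis the stable classes span x, and their restriction matrix is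
   invertible, so localized classes are detected on the fixed points. *)
Lemma localization_eq0 x : (exists v, localized loc S v = loc x) ->
  (forall k, fixed_pullback k x = 0) -> loc x = 0.
Proof.
move=> [v vx] x0; have [locZ _ loc0] := hloc.
have [d d0 [q qE]] := fraction_clear_family (fun p : 'I_N * 'I_N => v p.1 p.2).
(* The expansion of [loc x] with denominators cleared: [y] localizes to 0, so a nonzero [d'] kills
   it. As [x] vanishes at all fixed points, restricting [y] gives linear relations among the
   [q p]. *)
pose y := eqscalar phi X d * x - \sum_p eqscalar phi X (q p) * S (fixed_class R p).
have /loc0[d' d'0 y0] : loc y = 0.
  rewrite raddfB raddf_sum locZ -vx /localized pair_big /= scaler_sumr -sumrB big1 // => p _.
  by rewrite locZ -qE scalerA -surjective_pairing subrr.
suff q0 p : q p = 0.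
  have : FracField.tofrac d *: loc x = 0.
    rewrite -vx /localized pair_big /= scaler_sumr big1 // => p _.
    by rewrite scalerA qE q0 tofrac0 scale0r.
  by move/eqP; rewrite scaler_eq0 tofrac_eq0 (negPf d0) => /eqP.
apply: (stable_coef_free sigma0) => {p} k; apply/eqP.
have := congr1 (fixed_pullback k) y0.
rewrite raddf0 rmorphM /= rmorphB rmorphM /= x0 mulr0 sub0r rmorph_sum /=.
rewrite !fixed_pullback_eqscalar => e.
have : phi (d' * - \sum_p q p * stable_coef R sigma p k) = phi 0.
  rewrite rmorphM rmorphN rmorph_sum rmorph0 -[RHS]e; congr (_ * - _).
  apply: eq_bigr => p _.
  by rewrite [RHS]rmorphM /= fixed_pullback_eqscalar (stable_coefE hphi stabS sigma0) rmorphM.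
by move/(phi_inj hphi)/eqP; rewrite mulf_eq0 (negPf d'0) oppr_eq0.
Qed.

End Localization.

(** * The R-matrix *)

Theorem mainTheorem7 (R : realType) (N : nat) (hN : (2 <= N)%N)
  (c : eqcohom_pt R 1) (phi : {rmorphism eqpoly R -> eqcohom_pt R 3})
  (hphi : is_char_iso c phi)
  (sigma1 sigma2 : int * int)
  (hC1 : 0 < pairing sigma1 (u_char 0 - u_char 1))
  (hC2 : pairing sigma2 (u_char 0 - u_char 1) < 0)
  (Stab1 Stab2 : 'M[eqpoly R]_N -> eqcohom (@cotangent_flags R N))
  (hStab1 : stable_map phi sigma1 Stab1)
  (hStab2 : stable_map phi sigma2 Stab2)
  (L : lmodType (eqfrac R))
  (loc : {additive eqcohom (@cotangent_flags R N) -> L})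
  (hloc : is_localization phi loc)
  (Stab2_inv : L -> 'M[eqfrac R]_N)
  (hinv1 : cancel (localized loc Stab2) Stab2_inv)
  (hinv2 : cancel Stab2_inv (localized loc Stab2)) :
  let u : eqfrac R := tofrac (u_var R) in
  let h : eqfrac R := tofrac (h_var R) in
  forall v : 'M[eqfrac R]_N,
    (Stab2_inv \o localized loc Stab1) v =
    (u / (u + h)) *: v + (h / (u + h)) *: permutation_op v.
Proof.
move=> u h v.
have sigma1N0 : pairing sigma1 (u_char 0 - u_char 1) != 0 by rewrite gt_eqF.
have sigma2N0 : pairing sigma2 (u_char 0 - u_char 1) != 0 by rewrite lt_eqF.
have uh0 : u + h != 0 by rewrite -tofracD tofrac_eq0 uh_var_neq0.
have [locZ _ _] := hloc.
have stab1E i : loc (Stab1 (fixed_class R i)) =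
    (u / (u + h)) *: loc (Stab2 (fixed_class R i)) +
    (h / (u + h)) *: loc (Stab2 (fixed_class R (swap i))).
  pose X := @cotangent_flags R N.
  (* The difference of the two sides multiplied by u + hbar, formed before localization so that it
     can be restricted to fixed points. *)
  pose x := eqscalar phi X (u_var R + h_var R) * Stab1 (fixed_class R i) -
    (eqscalar phi X (u_var R) * Stab2 (fixed_class R i) +
     eqscalar phi X (h_var R) * Stab2 (fixed_class R (swap i))).
  have : loc x = 0.
    apply: (localization_eq0 hphi hStab2 sigma2N0 hloc) => [|k].
      by exists (Stab2_inv (loc x)); rewrite hinv2.
    rewrite /x rmorphB rmorphD !rmorphM /= !fixed_pullback_eqscalar.
    rewrite (stable_coefE hphi hStab1 sigma1N0) !(stable_coefE hphi hStab2 sigma2N0).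
    by rewrite -!rmorphM -rmorphD (stable_coef_exchange R i k hC1 hC2) subrr.
  rewrite raddfB raddfD !locZ tofracD -/u -/h => /eqP; rewrite subr_eq0 => /eqP e.
  apply: (scalerI uh0); rewrite e scalerDr !scalerA.
  by rewrite ![(u + h) * _]mulrC !divfK.
(* It remains to compare two double sums in [L]; the hbar parts match after the summation indices
   are exchanged, which accounts for the transpose. *)
rewrite -[RHS]hinv1; congr Stab2_inv; rewrite /localized.
under eq_bigr => i _ do under eq_bigr => j _ do
  rewrite stab1E /swap /= scalerDr !scalerA.
under [RHS]eq_bigr => i _ do under eq_bigr => j _ do rewrite !mxE scalerDl.
under eq_bigr => i _ do rewrite big_split.
under [RHS]eq_bigr => i _ do rewrite big_split.
rewrite !big_split /=; congr +%R; last rewrite exchange_big /=.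
  by apply: eq_bigr => i _; apply: eq_bigr => j _; rewrite mulrC.
by apply: eq_bigr => i _; apply: eq_bigr => j _; rewrite mulrC.
Qed.
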